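(* Let $k$ be a field with $\operatorname{char}(k)=0$ and $R=k[x_1,\dots,x_n]$. Let $I=\mathfrak m_{J_1}^{a_1}\cap\cdots\cap\mathfrak m_{J_s}^{a_s}\subset R$, where $s\ge 1$, $J_1,\dots,J_s$ are nonempty subsets of $[n]=\{1,\dots,n\}$ and $a_1,\dots,a_s$ are positive integers. Suppose either that $s\le 3$, or that $J_i\cup J_j=[n]$ for all $i\neq j$. Then $I$ satisfies the upper bound of the Multiplicity Conjecture, i.e. $$e(R/I)\le\frac{\prod_{i=1}^{c}M_i}{c!},$$ where $c=\operatorname{codim}(I)$.
   Context: For a nonempty subset $J=\{j_1,\dots,j_t\}\subseteq[n]$, $\mathfrak m_J=(x_{j_1},\dots,x_{j_t})\subset R$. $R$ is standard graded and $e(R/I)$ denotes the multiplicity of $R/I$. Writing the minimal graded free resolution of $R/I$ as $$0\to\bigoplus_{j=1}^{b_p}R(-d_{pj})\to\cdots\to\bigoplus_{j=1}^{b_1}R(-d_{1j})\to R\to R/I\to 0,$$ one sets $M_i=\max\{d_{ij}\mid j=1,\dots,b_i\}$. *)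

(* Defs.v *)
From HB Require Import structures.
From mathcomp Require Import all_boot all_order all_algebra.
From mathcomp Require Export mpoly.

Set Implicit Arguments.
Unset Strict Implicit.
Unset Printing Implicit Defensive.

Import Order.TTheory GRing.Theory Num.Theory.
Local Open Scope ring_scope.

Section Ideals.
Variable R : comNzRingType.

(* Ideals are [Prop]-valued predicates, so that generated ideals need no
   decidable membership test. *)
Definition is_ideal (I : R -> Prop) : Prop :=
  [/\ I 0, (forall f g, I f -> I g -> I (f + g))
    & (forall r f, I f -> I (r * f))].

Definition ideal_gen (S : R -> Prop) (f : R) : Prop :=
  exists (m : nat) (r g : 'I_m -> R),
    (forall i, S (g i)) /\ f = \sum_(i < m) r i * g i.

Definition ideal_pow (I : R -> Prop) (a : nat) : R -> Prop :=
  ideal_gen (fun f => exists g : 'I_a -> R,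
    (forall i, I (g i)) /\ f = \prod_(i < a) g i).

Definition is_prime (P : R -> Prop) : Prop :=
  [/\ is_ideal P, ~ P 1 & forall f g, P (f * g) -> P f \/ P g].

Definition ideal_le (I J : R -> Prop) : Prop := forall f, I f -> J f.
Definition ideal_lt (I J : R -> Prop) : Prop := ideal_le I J /\ ~ ideal_le J I.

(* Q 0 < Q 1 < ... < Q h = P, a chain of primes of length h; the values Q i
   with i > h are irrelevant. *)
Definition prime_chain (P : R -> Prop) (h : nat) : Prop :=
  exists Q : nat -> R -> Prop,
    [/\ (forall i, (i <= h)%N -> is_prime (Q i)),
        (forall i, (i < h)%N -> ideal_lt (Q i) (Q i.+1))
      & (forall f, Q h f <-> P f)].

Definition prime_height (P : R -> Prop) (h : nat) : Prop :=
  prime_chain P h /\ forall h', prime_chain P h' -> (h' <= h)%N.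

(* codim I = min { height P : P a prime containing I } *)
Definition codim (I : R -> Prop) (c : nat) : Prop :=
  (exists P, [/\ is_prime P, ideal_le I P & prime_height P c]) /\
  (forall P h, is_prime P -> ideal_le I P -> prime_height P h -> (c <= h)%N).

End Ideals.

Section GradedInvariants.
Variables (k : fieldType) (n : nat).
Local Notation R := {mpoly k[n]}.

(* m_J = (x_j : j in J) *)
Definition mJ (J : {set 'I_n}) : R -> Prop :=
  ideal_gen (fun f => exists2 j, j \in J & f = 'X_j).

(* H t = dim_k (R/I)_t for every t: H t forms of degree t are a k-basis
   of R_t modulo I. *)
Definition hilbert_function (I : R -> Prop) (H : nat -> nat) : Prop :=
  forall t, exists B : 'I_(H t) -> R,
    [/\ (forall i, B i \is t.-homog),
        (forall u : 'I_(H t) -> k,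
            I (\sum_i u i *: B i) -> forall i, u i = 0)
      & (forall f : R, f \is t.-homog ->
            exists u : 'I_(H t) -> k, I (f - \sum_i u i *: B i))].

(* e(R/I) = (deg P)! * lead_coeff P if the Hilbert polynomial P of R/I is
   nonzero (dim R/I > 0), and the length of R/I if P = 0 (dim R/I = 0). *)
Definition multiplicity (I : R -> Prop) (e : rat) : Prop :=
  exists (H : nat -> nat) (P : {poly rat}) (N : nat),
    [/\ hilbert_function I H,
        (forall t, (N <= t)%N -> (H t)%:R = P.[t%:R])
      & e = if P == 0 then (\sum_(t < N) H t)%:R
            else ((size P).-1`!)%:R * lead_coef P].

(* A minimal graded free resolution of R/I.  F_i has rank [rk i] and
   homogeneous basis elements of degrees [dg i j], i.e.
   F_i = (+)_j R(- dg i j).  The map F_(i+1) -> F_i is right multiplication of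
   row vectors by [dif i].  Degrees can be taken in nat: F_0 = R sits in degree
   0 and by minimality every later basis element has larger degree than some
   basis element of the previous module. *)
Record min_graded_resolution (I : R -> Prop) := MinGradedResolution {
  rk : nat -> nat;
  dg : forall i, 'I_(rk i) -> nat;
  dif : forall i, 'M[R]_(rk i.+1, rk i);
  rk0 : rk 0 = 1%N;
  dg0 : forall l, @dg 0 l = 0%N;
  rk_finite : exists p, forall i, (p < i)%N -> rk i = 0%N;
  dif_homog : forall i j l m,
    m \in msupp (dif i j l) -> (mdeg m + dg l = dg j)%N;
  (* the image of F_(i+1) lies in (x_1, ..., x_n) F_i *)
  dif_minimal : forall i j l, (dif i j l)@_0%MM = 0;
  (* as rk 0 = 1, [const_mx f] is f seen as an element of F_0 = R *)
  dif_augment : forall f,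
    I f <-> exists w : 'rV_(rk 1), w *m dif 0 = const_mx f;
  dif_exact : forall i (v : 'rV_(rk i.+1)),
    v *m dif i = 0 <-> exists w : 'rV_(rk i.+2), v = w *m dif i.+1
}.

Definition max_shift (I : R -> Prop) (F : min_graded_resolution I) (i : nat) :
  nat := \max_(j < rk F i) dg j.

End GradedInvariants.

(* Main.v *)
(** Both sides are compared with numbers read off the components. Let c be the
    codimension, which is the least size of a J_i, and for each component set
    X of size c let A_X be the largest exponent occurring with it.

    Counting monomials outside I gives e(R/I) <= sum_X C(A_X + c - 1, c): only
    the components of size c contribute to the leading term of the Hilbert
    polynomial.

    The codimension of I is computed without dimension theory: if Q < Q' are
    primes and f lies in Q' but not in Q, then a family independent modulo Q'
    together with f times a family independent modulo Q is independent modulo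
    Q, so each step of a chain of primes raises the growth exponent of R/Q by
    one.

    On the side of the resolution, M_1 >= A_X + A_Y for X <> Y, because some
    monomial of I avoids the variables of X :&: Y and each such monomial has
    degree at least A_X + A_Y. Moreover M_(i+1) > M_i for 1 <= i < c:
    otherwise a basis element of F_i of degree M_i would give a nonzero class
    of Ext^i(R/I, R), which vanishes since I contains a regular sequence of
    length c, namely powers of the elementary symmetric polynomials of degrees
    n, n - 1, ..., n - c + 1. Hence prod_i M_i / c! >= C(M_1 + c - 1, c).

    What is left is C(a + c - 1, c) + c C(b + c - 1, c) <= C(a + b + c - 1, c)
    for 1 <= b <= a, as the hypotheses leave at most c + 1 components of size
    c (or c = 1, when the sets X are disjoint and M_1 >= sum_X A_X). *)

Require Import Defs.
From mathcomp Require Import all_boot all_order all_algebra.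
From mathcomp Require Import zify ring lra.
From Stdlib Require Import Classical.
Import Order.TTheory GRing.Theory Num.Theory.
Local Open Scope ring_scope.

Set Implicit Arguments.
Unset Strict Implicit.
Unset Printing Implicit Defensive.

(** * Monomial ideals *)

Section IdealBasics.
Variable R : comNzRingType.
Implicit Types (A B : R -> Prop) (f g r : R).

Lemma ideal_opp A f : is_ideal A -> A f -> A (- f).
Proof. by case=> _ _ hM /(hM (-1)); rewrite mulN1r. Qed.

Lemma ideal_sub A f g : is_ideal A -> A f -> A g -> A (f - g).
Proof. by move=> hA hf /(ideal_opp hA); case: hA => _ hD _; apply: hD. Qed.

Lemma ideal_mulr A f r : is_ideal A -> A f -> A (f * r).
Proof. by case=> _ _ hM /(hM r); rewrite mulrC. Qed.

Lemma ideal_sum A (T : Type) (s : seq T) (P : pred T) (F : T -> R) :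
  is_ideal A -> (forall i, P i -> A (F i)) -> A (\sum_(i <- s | P i) F i).
Proof. by case=> h0 hD _ hF; apply: (big_ind A). Qed.

Lemma ideal_prod A (T : finType) (F : T -> R) i :
  is_ideal A -> A (F i) -> A (\prod_j F j).
Proof. by move=> hA hi; rewrite (bigD1 i) //=; apply: ideal_mulr. Qed.

Lemma is_ideal_gen (S : R -> Prop) : is_ideal (ideal_gen S).
Proof.
split.
- exists 0%N, (fun=> 0), (fun=> 0); split; first by case.
  by rewrite big_ord0.
- move=> f g [m1 [r1 [g1 [h1 ->]]]] [m2 [r2 [g2 [h2 ->]]]].
  exists (m1 + m2)%N, (fun i => match split i with inl j => r1 j | inr j => r2 j end),
    (fun i => match split i with inl j => g1 j | inr j => g2 j end); split.
    by move=> i; case: (split i).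
  rewrite big_split_ord /=; congr (_ + _); apply: eq_bigr => i _.
    by have := unsplitK (inl i : 'I_m1 + 'I_m2) => /= ->.
  by have := unsplitK (inr i : 'I_m1 + 'I_m2) => /= ->.
- move=> r f [m [r1 [g [hg ->]]]].
  exists m, (fun i => r * r1 i), g; split=> //.
  by rewrite mulr_sumr; apply: eq_bigr => i _; rewrite mulrA.
Qed.

Lemma mem_ideal_gen (S : R -> Prop) f : S f -> ideal_gen S f.
Proof.
by exists 1%N, (fun=> 1), (fun=> f); split=> //; rewrite big_ord1 mul1r.
Qed.

Lemma ideal_gen_min (S : R -> Prop) A f :
  is_ideal A -> (forall g, S g -> A g) -> ideal_gen S f -> A f.
Proof.
move=> hA hS [m [r [g [hg ->]]]]; apply: ideal_sum => // i _.
by case: hA => _ _; apply; apply: hS.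
Qed.

Lemma is_prime_prod P (T : finType) (F : T -> R) :
  is_prime P -> P (\prod_i F i) -> exists i, P (F i).
Proof.
case=> hP h1 hM; suff: forall s : seq T, P (\prod_(i <- s) F i) -> exists i, P (F i).
  by apply.
elim=> [|i s IH]; first by rewrite big_nil.
by rewrite big_cons => /hM [hi|/IH //]; exists i.
Qed.

Lemma is_prime_exp P f a : is_prime P -> P (f ^+ a) -> P f.
Proof.
case=> hP h1 hM; elim: a => [|a IH]; first by rewrite expr0.
by rewrite exprS => /hM [].
Qed.

End IdealBasics.

Section MonomialIdeals.
Variables (k : fieldType) (n : nat).
Local Notation R := {mpoly k[n]}.
Local Notation mon := 'X_{1..n}.
Implicit Types (J V : {set 'I_n}) (m : mon) (f g : R) (Q : pred mon).

Definition wdeg J m : nat := (\sum_(j in J) m j)%N.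

Lemma wdegD J m1 m2 : wdeg J (m1 + m2)%MM = (wdeg J m1 + wdeg J m2)%N.
Proof. by rewrite /wdeg -big_split /=; apply: eq_bigr => j _; rewrite mnmDE. Qed.

Lemma wdegU J j : wdeg J U_(j)%MM = (j \in J).
Proof.
rewrite /wdeg; case: (boolP (j \in J)) => hj.
  rewrite (bigD1 j) //= mnm1E eqxx big1 // => i /andP [_ /negbTE].
  by rewrite mnm1E eq_sym => ->.
rewrite big1 // => i hi; rewrite mnm1E; case: eqP => // e.
by rewrite -e (negbTE hj) in hi.
Qed.

Lemma wdegMn J m a : wdeg J (m *+ a)%MM = (wdeg J m * a)%N.
Proof. by rewrite /wdeg big_distrl /=; apply: eq_bigr => j _; rewrite mulmnE. Qed.

Lemma wdegT m : wdeg setT m = mdeg m.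
Proof. by rewrite mdegE /wdeg; apply: eq_bigl => i; rewrite inE. Qed.

Lemma wdegC J m : (wdeg J m + wdeg (~: J) m)%N = mdeg m.
Proof.
rewrite mdegE [RHS](bigID (mem J)) /=; congr addn; rewrite /wdeg.
by apply: eq_bigl => i; rewrite inE.
Qed.

Lemma wdeg_gt0P J m : reflect (exists2 j, j \in J & (0 < m j)%N) (0 < wdeg J m)%N.
Proof.
rewrite lt0n; apply: (iffP idP) => [|[j hj hm]].
  rewrite /wdeg sum_nat_eq0 negb_forall => /existsP [j].
  by rewrite negb_imply -lt0n => /andP [hj hm]; exists j.
by rewrite -lt0n /wdeg (bigD1 j) //=; apply: leq_trans hm (leq_addr _ _).
Qed.

Lemma mnm_decomp m j : (0 < m j)%N -> m = (m - U_(j) + U_(j))%MM.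
Proof. by move=> h; rewrite submK // lep1mP -lt0n. Qed.

(* Ideals with a monomial basis: [Q] selects the monomials of the ideal. *)
Definition monomial_ideal (Q : pred mon) f : Prop := {in msupp f, forall m, Q m}.

Definition up_closed (Q : pred mon) : Prop := forall m m', Q m -> Q (m' + m)%MM.

Lemma monomial_idealX Q m : monomial_ideal Q 'X_[m] <-> Q m.
Proof.
split=> [h|h m']; first by apply: h; rewrite msuppX inE.
by rewrite msuppX inE => /eqP ->.
Qed.

Lemma monomial_idealD Q f g : monomial_ideal Q f -> monomial_ideal Q g -> monomial_ideal Q (f + g).
Proof.
by move=> hf hg m /msuppD_le; rewrite mem_cat => /orP [/hf|/hg].
Qed.

Lemma is_ideal_monomial_ideal Q : up_closed Q -> is_ideal (monomial_ideal Q).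
Proof.
move=> hQ; split; [by move=> m; rewrite msupp0 | exact: monomial_idealD |].
move=> r f hf m /msuppM_le /allpairsP [[m1 m2] /= [h1 /hf h2 ->]].
exact: hQ.
Qed.

Lemma monomial_ideal_ideal (Q : pred mon) (A : R -> Prop) f :
  is_ideal A -> (forall m, Q m -> A 'X_[m]) -> monomial_ideal Q f -> A f.
Proof.
move=> hA hX hf; rewrite (mpolyE f) big_seq; apply: ideal_sum => // m hm.
by rewrite -mul_mpolyC; case: (hA) => _ _; apply; apply: hX; apply: hf.
Qed.

(** The monomial description of the ideal power m_J^a; see [ideal_pow_mJ]. *)
Definition weight_ideal J a := monomial_ideal (fun m => a <= wdeg J m)%N.

Lemma is_ideal_weight_ideal J a : is_ideal (weight_ideal J a).
Proof.
by apply: is_ideal_monomial_ideal => m m' h; rewrite wdegD (leq_trans h) // leq_addl.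
Qed.

Lemma weight_idealM J a b f g :
  weight_ideal J a f -> weight_ideal J b g -> weight_ideal J (a + b) (f * g).
Proof.
move=> hf hg m /msuppM_le /allpairsP [[m1 m2] /= [/hf h1 /hg h2 ->]].
by rewrite wdegD leq_add.
Qed.

Lemma weight_ideal_prod J a (F : 'I_a -> R) :
  (forall i, weight_ideal J 1 (F i)) -> weight_ideal J a (\prod_i F i).
Proof.
elim: a F => [|a IH] F hF; first by move=> m _.
by rewrite big_ord_recl; apply: (weight_idealM (a := 1) (hF _)); apply: IH => i; apply: hF.
Qed.

Lemma mJ_weight_ideal J f : mJ J f <-> weight_ideal J 1 f.
Proof.
split.
  apply: ideal_gen_min (is_ideal_weight_ideal J 1) _ => _ [j hj ->].
  by apply/monomial_idealX; rewrite wdegU hj.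
apply: monomial_ideal_ideal; first exact: is_ideal_gen.
move=> m /wdeg_gt0P [j hj /mnm_decomp ->]; rewrite mpolyXD.
have [_ _] := is_ideal_gen (fun f : R => exists2 j, j \in J & f = 'X_j).
by apply; apply: mem_ideal_gen; exists j.
Qed.

Lemma ideal_pow_mJ J a f : ideal_pow (@mJ k n J) a f <-> weight_ideal J a f.
Proof.
split.
  apply: ideal_gen_min (is_ideal_weight_ideal J a) _ => _ [g [hg ->]].
  by apply: weight_ideal_prod => i; apply/mJ_weight_ideal.
apply: monomial_ideal_ideal; first exact: is_ideal_gen.
move=> m hm.
(* Peel off variables of J one at a time, [a] of them in all; what is left of the monomial becomes
   r. *)
suff [r [g [hg ->]]] : exists r (g : 'I_a -> R),
    (forall i, mJ J (g i)) /\ 'X_[m] = r * \prod_i g i.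
  have [_ _] := is_ideal_gen (fun f : R => exists g : 'I_a -> R,
      (forall i, mJ J (g i)) /\ f = \prod_i g i).
  by apply; apply: mem_ideal_gen; exists g.
elim: a m hm => [|a IH] m hm.
  by exists 'X_[m], (fun=> 0); split; [case | rewrite big_ord0 mulr1].
have /wdeg_gt0P [j hj /mnm_decomp em] : (0 < wdeg J m)%N by apply: leq_trans hm.
have [|r [g [hg e]]] := IH (m - U_(j))%MM.
  by move: hm; rewrite {1}em wdegD wdegU hj addn1.
exists r, (fun i => if unlift ord0 i is Some i' then g i' else 'X_j); split.
  move=> i; case: unliftP => [i' _|_]; first exact: hg.
  by apply: mem_ideal_gen; exists j.
rewrite big_ord_recl unlift_none {1}em mpolyXD e mulrAC -mulrA; congr (_ * _).
by congr (_ * _); apply: eq_bigr => i _; rewrite liftK.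
Qed.

Definition kill J f : R := f \mPo [tuple (if i \in J then 0 else 'X_i) | i < n].

Lemma killX J m : kill J 'X_[m] = if (0 < wdeg J m)%N then 0 else 'X_[m].
Proof.
rewrite /kill comp_mpolyX.
case: (wdeg_gt0P J m) => [[j hj hm]|h].
  by rewrite (bigD1 j) //= tnth_mktuple hj expr0n -[_ == _]negbK -lt0n hm mul0r.
rewrite [RHS]mpolyXE_id; apply: eq_bigr => i _; rewrite tnth_mktuple.
case: ifP => // hi; case e: (m i) => [|p]; first by rewrite !expr0.
by case: h; exists i; rewrite ?e.
Qed.

Lemma kill_eq0 J f : kill J f = 0 <-> weight_ideal J 1 f.
Proof.
have kE : kill J f = \sum_(m <- msupp f)
    f@_m *: (if (0 < wdeg J m)%N then 0 else 'X_[m]).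
  rewrite {1}(mpolyE f) /kill raddf_sum /=; apply: eq_bigr => m _.
  by rewrite comp_mpolyZ -killX.
split=> [h m hm|h].
  case: (boolP (0 < wdeg J m)%N) => // hw.
  have := congr1 (mcoeff m) h; rewrite kE raddf_sum /= mcoeff0.
  rewrite (bigD1_seq m) ?msupp_uniq //= (negbTE hw) mcoeffZ mcoeffX eqxx mulr1.
  rewrite big1 ?addr0 => [e|m' ne].
    by move: hm; rewrite mcoeff_msupp e eqxx.
  by rewrite mcoeffZ; case: ifP => _; rewrite ?mcoeff0 ?mcoeffX ?(negbTE ne) mulr0.
rewrite kE big_seq big1 // => m /h ->; exact: scaler0.
Qed.

(** The ideal m_J is the kernel of the endomorphism [kill J] of a domain. *)
Lemma is_prime_weight_ideal J : is_prime (weight_ideal J 1).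
Proof.
split; first exact: is_ideal_weight_ideal.
  by move=> /(_ 0%MM); rewrite msupp1 inE eqxx => /(_ isT) /wdeg_gt0P [j]; rewrite mnm0E.
move=> f g /kill_eq0; rewrite /kill rmorphM /= => /eqP.
by rewrite mulf_eq0 => /orP [] /eqP h; [left | right]; apply/kill_eq0.
Qed.

Lemma weight_ideal_XU J i : weight_ideal J 1 'X_i <-> i \in J.
Proof.
split=> [/monomial_idealX|h]; first by rewrite wdegU; case: (i \in J).
by apply/monomial_idealX; rewrite wdegU h.
Qed.

End MonomialIdeals.

(** * Regular sequences and vanishing of Ext *)

Section RegularSequences.
Variable R : comNzRingType.
Implicit Types (A B : R -> Prop) (f g h r : R) (fs : seq R).

Definition adjoin A f r : Prop := exists s, A (r - s * f).

Definition colon A f r : Prop := A (f * r).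

(** Weak regularity: the final quotient may be zero, so every sequence is regular modulo the unit
    ideal. *)
Fixpoint regular_seq A fs : Prop :=
  if fs is f :: fs' then
    (forall r, A (f * r) -> A r) /\ regular_seq (adjoin A f) fs'
  else True.

Lemma is_ideal_adjoin A f : is_ideal A -> is_ideal (adjoin A f).
Proof.
case=> h0 hD hM; split.
- by exists 0; rewrite mul0r subr0.
- move=> x y [s hs] [t ht]; exists (s + t).
  by rewrite mulrDl opprD addrACA; apply: hD.
- move=> r x [s hs]; exists (r * s).
  by rewrite -mulrA -mulrBr; apply: hM.
Qed.

Lemma sub_adjoin A f r : A r -> adjoin A f r.
Proof. by move=> h; exists 0; rewrite mul0r subr0. Qed.

Lemma adjoin_self A f : is_ideal A -> adjoin A f f.
Proof. by case=> h0 _ _; exists 1; rewrite mul1r subrr. Qed.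

Lemma adjoin_min A B f :
  is_ideal B -> (forall r, A r -> B r) -> B f -> forall r, adjoin A f r -> B r.
Proof.
move=> hB hA hf r [s /hA hr]; case: hB => _ hD hM.
by rewrite -(subrK (s * f) r); apply: hD (hr) _; apply: hM.
Qed.

Lemma regular_seq_ext A B fs :
  (forall r, A r <-> B r) -> regular_seq A fs -> regular_seq B fs.
Proof.
elim: fs A B => //= f fs IH A B hAB [h1 h2]; split.
  by move=> r /hAB /h1 /hAB.
by apply: IH h2 => r; split=> -[s /hAB hs]; exists s.
Qed.

Lemma regular_seq_full A fs : (forall r, A r) -> regular_seq A fs.
Proof.
by elim: fs A => //= f fs IH A hA; split=> //; apply: IH => r; apply: sub_adjoin.
Qed.

(* Multiplication by [h] gives the exact sequence
   0 -> R/(A : h) -> R/A -> R/(A + (h)) -> 0, along which regularity passes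
   from the outer terms to the middle one. *)
Lemma regular_seq_split A h fs : is_ideal A ->
  regular_seq (colon A h) fs -> regular_seq (adjoin A h) fs -> regular_seq A fs.
Proof.
elim: fs A => //= f fs IH A hA [c1 c2] [a1 a2].
have [h0 hD hM] := hA; split=> [r hr|].
  have /a1 [s hs] : adjoin A h (f * r) by apply: sub_adjoin.
  rewrite -(subrK (s * h) r); apply: hD => //; rewrite mulrC.
  apply: c1; rewrite /colon.
  rewrite (_ : _ * _ = f * r - f * (r - s * h)); last by ring.
  by apply: ideal_sub => //; apply: hM.
apply: IH; first exact: is_ideal_adjoin.
  (* (A : h) + (f) equals (A + (f)) : h. If h r = s f modulo A, regularity of f modulo A + (h) gives
     s = t h modulo A, and then r - t f lies in A : h. *)
  apply: regular_seq_ext c2 => r; split=> [[s hs]|[s hs]].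
    by exists (h * s); rewrite -mulrA -mulrBr.
  have /a1 [t ht] : adjoin A h (f * s).
    exists r; rewrite -opprB; apply: ideal_opp => //.
    by rewrite mulrC [f * s]mulrC.
  exists t; rewrite /colon.
  rewrite (_ : _ * _ = (h * r - s * f) + f * (s - t * h)).
    by apply: hD => //; apply: hM.
  by ring.
apply: regular_seq_ext a2 => r.
split=> -[s [t hst]]; exists t, s; move: hst; by rewrite addrAC.
Qed.

End RegularSequences.

(** * Growth of the maximal shifts *)

Section MaxShifts.
Variables (k : fieldType) (n : nat) (I : {mpoly k[n]} -> Prop).
Variable F : min_graded_resolution I.
Local Notation R := {mpoly k[n]}.
Local Notation d := (@dif k n I F).

Lemma dif_dif i : d i.+1 *m d i = 0.
Proof.
apply/row_matrixP => j; rewrite row_mul row0.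
by apply/dif_exact; exists (delta_mx 0 j); rewrite -rowE.
Qed.

Lemma ord_rk0 (x y : 'I_(rk F 0)) : x = y.
Proof.
have := rk0 F; have := ltn_ord x; have := ltn_ord y => ? ? ?.
by apply: ord_inj; lia.
Qed.

Lemma mx_lift_rows p q r (X : 'M[R]_(p, q)) (Y : 'M_(r, q)) :
  (forall v : 'rV_p, exists w : 'rV_r, v *m X = w *m Y) ->
  exists S : 'M_(p, r), X = S *m Y.
Proof.
move=> h.
have /fin_all_exists [w hw] : forall j : 'I_p, exists w : 'rV_r, row j X = w *m Y.
  by move=> j; have [w hw] := h (delta_mx 0 j); exists w; rewrite rowE.
exists (\matrix_j w j); apply/row_matrixP => j.
by rewrite row_mul rowK.
Qed.

(** Multiplication by f is zero on R/I, hence null-homotopic on F. The second equation is the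
    induction invariant: it says that d_i kills the rows of f - d_i s, which therefore factor
    through d_(i+1) by exactness. *)
Lemma null_homotopy f i : I f ->
  exists (s : 'M_(rk F i, rk F i.+1)) (t : 'M_(rk F i.+1, rk F i.+2)),
    f%:M = d i *m s + t *m d i.+1 /\ d i *m (f%:M - s *m d i) = 0.
Proof.
move=> If.
have step j (s : 'M_(rk F j, rk F j.+1)) : d j *m (f%:M - s *m d j) = 0 ->
    exists t : 'M_(rk F j.+1, rk F j.+2), f%:M = d j *m s + t *m d j.+1.
  move=> hs; have [|t ht] := @mx_lift_rows _ _ _ (f%:M - d j *m s) (d j.+1).
    move=> v; apply/dif_exact.
    rewrite -mulmxA mulmxBl -scalar_mxC.
    by rewrite -mulmxA -mulmxBr hs mulmx0.
  by exists t; rewrite -ht addrCA subrr addr0.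
suff [s hs] : exists s : 'M_(rk F i, rk F i.+1), d i *m (f%:M - s *m d i) = 0.
  by have [t ht] := step _ _ hs; exists s, t.
elim: i => [|i [s hs]].
  have [|s hs] := @mx_lift_rows _ _ _ (f%:M : 'M_(rk F 0)) (d 0); last first.
    by exists s; rewrite -hs subrr mulmx0.
  move=> v; have e1 : rk F 0 = 1%N := rk0 F.
  have [_ _ hM] : is_ideal I.
    split=> [|x y /(dif_augment F) [u hu] /(dif_augment F) [w hw]
             |x y /(dif_augment F) [w hw]]; apply/(dif_augment F).
    - by exists 0; rewrite mul0mx; apply/matrixP => a b; rewrite !mxE.
    - by exists (u + w); rewrite mulmxDl hu hw; apply/matrixP => a b; rewrite !mxE.
    - by exists (x *: w); rewrite -scalemxAl hw; apply/matrixP => a b; rewrite !mxE.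
  have o0 : 'I_(rk F 0) by rewrite e1; exact: ord0.
  have /(dif_augment F) [w hw] := hM (v 0 o0) f If.
  exists w; rewrite hw mul_mx_scalar; apply/matrixP => a b; rewrite !mxE ord1 mulrC.
  by congr (v _ _ * _); apply: ord_rk0.
have [t ht] := step _ _ hs; exists t.
by rewrite ht addrK mulmxA dif_dif mul0mx.
Qed.

(** A column with rk F i entries is an element of Hom(F_i, R/A). As the differentials act on rows
    from the right, the dual complex acts on columns from the left. *)
Definition cocycle_mod (A : R -> Prop) i (phi : 'cV[R]_(rk F i)) : Prop :=
  forall j, A ((d i *m phi) j 0).

Definition coboundary_mod (A : R -> Prop) i : 'cV[R]_(rk F i) -> Prop :=
  if i is i'.+1 return 'cV[R]_(rk F i) -> Prop then
    fun phi => exists psi, forall j, A ((phi - d i' *m psi) j 0)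
  else fun phi => forall j, A (phi j 0).

Lemma ideal_mulmx (A : R -> Prop) p q (X : 'M_(p, q)) (v : 'cV[R]_q) :
  is_ideal A -> (forall j, A (v j 0)) -> forall j, A ((X *m v) j 0).
Proof.
move=> hA hv j; rewrite mxE; apply: ideal_sum => // l _.
by case: hA => _ _; apply.
Qed.

(* That is, Ext^i(R/I, R/A) = 0.  An f in I acts on F by zero up to homotopy, so
   the class of phi is f-torsion, and the connecting map moves it to
   Ext^(i-1)(R/I, R/(A + f)). *)
Lemma ext_vanishing i (A : R -> Prop) (fs : seq R) (phi : 'cV_(rk F i)) :
  is_ideal A -> (forall f, f \in fs -> I f) -> regular_seq A fs ->
  (i < size fs)%N -> cocycle_mod A phi -> coboundary_mod A phi.
Proof.
elim: i A fs phi => [|i IH] A [|f fs] //= phi hA hI [reg1 reg2] hi hphi.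
  move=> j; apply: reg1.
  have If : I f by apply: hI; rewrite inE eqxx.
  have [w hw] := (dif_augment F f).1 If.
  have : A ((w *m (d 0 *m phi)) 0 0) by apply: ideal_mulmx.
  rewrite mulmxA hw mxE (bigD1 j) //= big1 ?addr0 ?mxE // => l ne.
  by case/eqP: ne; apply: ord_rk0.
have If : I f by apply: hI; rewrite inE eqxx.
have [s [t [hst _]]] := null_homotopy i If.
have hAf : is_ideal (adjoin A f) by apply: is_ideal_adjoin.
(* The homotopy applied to a cocycle: modulo A, f phi is the coboundary of s phi, so s phi is a
   cocycle modulo A + (f). *)
have key j : A ((f *: phi - d i *m (s *m phi)) j 0).
  rewrite -mul_scalar_mx hst mulmxDl mulmxA addrAC subrr add0r -mulmxA.
  exact: ideal_mulmx.
have : coboundary_mod (adjoin A f) (s *m phi).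
  apply: (IH _ fs) => // [g hg|j]; first by apply: hI; rewrite inE hg orbT.
  exists (phi j 0); rewrite -[X in A X]opprB; apply: ideal_opp => //.
  by have := key j; rewrite !mxE mulrC.
(* If s phi = rho + f chi modulo A with rho a cocycle, then f (phi - d chi) vanishes modulo A, and f
   can be cancelled. *)
move=> hcob; suff [chi [rho [hrho hchi]]] : exists chi rho, d i *m rho = 0 /\
    forall j, A ((s *m phi - rho - f *: chi) j 0).
  exists chi => j; apply: reg1.
  rewrite (_ : _ * _ = (f *: phi - d i *m (s *m phi)) j 0 +
      (d i *m (s *m phi - rho - f *: chi)) j 0).
    by case: (hA) => _ hD _; apply: hD (key j) _; apply: ideal_mulmx.
  rewrite !mulmxBr hrho subr0 -scalemxAr.
  have -> (x y z : 'cV[R]_(rk F i.+1)) : (x - y) j 0 + (y - z) j 0 = (x - z) j 0.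
    by rewrite !mxE addrA subrK.
  by rewrite -scalerBr [RHS]mxE.
have lift_adjoin (v : 'cV[R]_(rk F i)) : (forall j, adjoin A f (v j 0)) ->
    exists chi, forall j, A ((v - f *: chi) j 0).
  move=> /fin_all_exists [c hc]; exists (\col_j c j) => j.
  by have := hc j; rewrite !mxE mulrC.
case: i IH phi hi hphi s t hst key hcob lift_adjoin
    => [|i] IH phi hi hphi s t hst key hcob lift_adjoin; move: hcob => /=.
  by move=> /lift_adjoin [chi hchi]; exists chi, 0; rewrite mulmx0 subr0.
case=> psi /lift_adjoin [chi hchi]; exists chi, (d i *m psi).
by rewrite mulmxA dif_dif mul0mx.
Qed.

(** Suppose M_(i+1) <= M_i and take a basis element of F_i of degree M_i. The entries of the
    differential in its column have degree at most 0, so they vanish by minimality and the dual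
    basis vector is a cocycle. By [ext_vanishing] with A = 0 it is a coboundary, but coboundaries
    have no constant terms. *)
Lemma max_shift_lt i (fs : seq R) :
  (forall f, f \in fs -> I f) -> regular_seq (fun r => r = 0) fs ->
  (0 < i < size fs)%N -> (0 < max_shift F i)%N ->
  (max_shift F i < max_shift F i.+1)%N.
Proof.
move=> hI hreg; case: i => [|i] // /= hi hpos; rewrite ltnNge; apply/negP => hle.
have [|l hl] := @bigop.eq_bigmax _ (@dg _ _ _ F i.+1).
  rewrite card_ord lt0n; apply: contraTneq hpos => e.
  rewrite /max_shift big1 // => j _.
  by exfalso; case: j => j; rewrite e.
have col0 : d i.+1 *m delta_mx l 0 = 0 :> 'cV_(rk F i.+2).
  apply/colP => j; rewrite -colE !mxE; apply/mpolyP => m; rewrite mcoeff0.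
  apply/eqP; rewrite mcoeff_eq0; apply/negP => hm.
  have := dif_homog hm; rewrite -hl => e.
  have : (dg j <= max_shift F i.+1)%N.
    by apply: leq_trans hle; apply: (leq_bigmax j).
  rewrite -e /max_shift -[X in (_ <= X)%N]add0n leq_add2r leqn0 mdeg_eq0 => /eqP m0.
  by move: hm; rewrite m0 mcoeff_msupp dif_minimal eqxx.
have h0 : is_ideal (fun r : R => r = 0).
  by split=> // [f g -> ->|r f ->]; rewrite ?addr0 ?mulr0.
have [//|psi hpsi] := @ext_vanishing i.+1 (fun r => r = 0) fs (delta_mx l 0)
  h0 hI hreg hi _.
  by move=> j; rewrite col0 mxE.
have := congr1 (mcoeff 0%MM) (hpsi l).
rewrite !mxE !eqxx mcoeffB mcoeff1 eqxx mcoeff0 raddf_sum /= big1 ?subr0.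
  by move/eqP; rewrite oner_eq0.
by move=> j _; rewrite rmorphM /= dif_minimal mul0r.
Qed.

End MaxShifts.

Section RegularProducts.
Variable R : comNzRingType.
Implicit Types (A : R -> Prop) (f g h r : R) (fs gs : seq R).

Lemma adjoin_congr A f g r : is_ideal A -> A (f - g) -> adjoin A f r -> adjoin A g r.
Proof.
move=> hA hfg; apply: adjoin_min; [exact: is_ideal_adjoin|exact: sub_adjoin|].
by exists 1; rewrite mul1r.
Qed.

(** Induction on the factors by [regular_seq_split]: if h is the product of the factors after g,
    then (A + (g h)) : h = A + (g), since h is a nonzerodivisor modulo A, and A + (g h) + (h) = A +
    (h). *)
Lemma regular_seq_prod A fs gs : is_ideal A ->
  (forall g, g \in gs -> (forall r, A (g * r) -> A r) /\ regular_seq (adjoin A g) fs) ->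
  regular_seq (adjoin A (\prod_(g <- gs) g)) fs.
Proof.
move=> hA; elim: gs => [|g gs IH] hgs.
  (* The empty product is 1, and A + (1) is the whole ring. *)
  apply: regular_seq_full => r; rewrite big_nil; exists r.
  by rewrite mulr1 subrr; case: hA.
have hgs' g' : g' \in gs ->
    (forall r, A (g' * r) -> A r) /\ regular_seq (adjoin A g') fs.
  by move=> hg'; apply: hgs; rewrite inE hg' orbT.
have nzd r : A (\prod_(g <- gs) g * r) -> A r.
  elim: gs hgs' {IH hgs} => [|g' gs IH'] hgs'; first by rewrite big_nil mul1r.
  have [hr _] := hgs' g' (mem_head _ _).
  rewrite big_cons -mulrA => /hr; apply: IH' => g1 h1.
  by apply: hgs'; rewrite inE h1 orbT.
rewrite big_cons; set h := \prod_(g <- gs) g in IH nzd *.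
apply: (regular_seq_split (h := h)); first exact: is_ideal_adjoin.
  have [_] := hgs g (mem_head _ _); apply: regular_seq_ext => r.
  split=> -[s hs]; exists s.
    have [_ _ hM] := hA; have := hM h _ hs; congr A; ring.
  by apply: nzd; move: hs; congr A; ring.
apply: regular_seq_ext (IH hgs') => r; split.
  by apply: adjoin_min; [do 2?apply: is_ideal_adjoin | move=> x hx; do 2!apply: sub_adjoin
    | apply: adjoin_self; exact: is_ideal_adjoin].
apply: adjoin_min; [exact: is_ideal_adjoin| |exact: adjoin_self].
move=> x; apply: adjoin_min; [exact: is_ideal_adjoin|exact: sub_adjoin|].
by exists g; rewrite subrr; case: hA.
Qed.

End RegularProducts.

(** * Regular sequences of powers of elementary symmetric polynomials *)

Section SymmetricRegular.
Variables (k : fieldType) (n : nat).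
Local Notation R := {mpoly k[n]}.
Local Notation es := (@mesym n k).
Implicit Types (J : {set 'I_n}).

Lemma adjoin_weight_ideal J i r :
  adjoin (@weight_ideal k n J 1) 'X_i r <-> weight_ideal (i |: J) 1 r.
Proof.
have hW J' := @is_ideal_weight_ideal k n J' 1.
have hU m : wdeg (i |: J) m = 0%N -> wdeg J m = 0%N /\ m i = 0%N.
  move=> h0; suff [] : ~ (0 < wdeg J m)%N /\ ~ (0 < m i)%N by lia.
  have hn : ~ (0 < wdeg (i |: J) m)%N by rewrite h0.
  split=> h; apply: hn.
    by case/wdeg_gt0P: h => j hj hm; apply/wdeg_gt0P; exists j; rewrite // !inE hj orbT.
  by apply/wdeg_gt0P; exists i; rewrite // !inE eqxx.
split.
  apply: adjoin_min => //; last by apply/weight_ideal_XU; rewrite !inE eqxx.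
  by move=> f hf m /hf; have := @hU m; lia.
apply: monomial_ideal_ideal; first exact: is_ideal_adjoin.
move=> m /wdeg_gt0P [j]; rewrite !inE => /orP [/eqP -> hm|hj hm].
  rewrite (mnm_decomp hm) mpolyXD.
  by have [_ _] := is_ideal_adjoin 'X_i (hW J); apply; apply: adjoin_self.
by apply: sub_adjoin; apply/monomial_idealX/wdeg_gt0P; exists j.
Qed.

Lemma wdeg_mesym1 J (h : {set 'I_n}) : wdeg J (mesym1 h) = #|J :&: h|.
Proof.
rewrite /wdeg -sum1_card [RHS](eq_bigl (fun j => (j \in J) && (j \in h))); last first.
  by move=> j; rewrite inE.
by rewrite big_mkcondr; apply: eq_bigr => j _; rewrite mnmE; case: (j \in h).
Qed.

(** A squarefree monomial of degree larger than n - |J| must involve a variable of J. *)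
Lemma mesym_weight_ideal J i : (n < i + #|J|)%N -> weight_ideal J 1 (es i).
Proof.
move=> hi m; rewrite msupp_mesymP => /existsP [h /andP [/eqP hc /eqP ->]]; rewrite wdeg_mesym1.
have := cardsUI J h; have : (#|J :|: h| <= n)%N.
  by rewrite -[X in (_ <= X)%N]card_ord max_card.
by rewrite hc; lia.
Qed.

(** Among the subsets of size n - |J|, only the complement of J avoids J. *)
Lemma mesym_congr J : weight_ideal J 1 (es (n - #|J|) - 'X_[mesym1 (~: J)]).
Proof.
rewrite mesymE (bigD1 (~: J)) /=; last first.
  have hcd : (#|J| + #|~: J| = n)%N by rewrite cardsC card_ord.
  by apply/eqP; rewrite -(addKn #|J| #|~: J|) hcd.
rewrite addrAC subrr add0r.
apply: ideal_sum => [|h /andP [/eqP hc hne]]; first exact: is_ideal_weight_ideal.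
apply/monomial_idealX; rewrite wdeg_mesym1 card_gt0; apply: contra hne.
rewrite setI_eq0 disjoint_sym disjoints_subset => hd; rewrite eqEcard hd hc.
have hcd : (#|J| + #|~: J| = n)%N by rewrite cardsC card_ord.
by rewrite -[X in (X <= _)%N](addKn #|J|) hcd leqnn.
Qed.

(* Modulo the variables in J, the polynomial s_(n-|J|) is the product of the
   remaining variables x_i; modulo each such x_i the rest of the sequence is
   the same kind of sequence for J + {i}. *)
Lemma mesym_regular a c J : (c + #|J| <= n)%N ->
  regular_seq (@weight_ideal k n J 1) (mkseq (fun i => es (n - #|J| - i) ^+ a) c).
Proof.
elim: c J => [|c IH] J hc //=.
have hW := @is_ideal_weight_ideal k n J 1; have hP := @is_prime_weight_ideal k n J.
set w := 'X_[mesym1 (~: J)] : R; have hw := @mesym_congr J.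
have w_notin : ~ weight_ideal J 1 w.
  by move/monomial_idealX; rewrite wdeg_mesym1 setICr cards0.
have s_notin : ~ weight_ideal J 1 (es (n - #|J|)).
  by move=> hs; apply: w_notin; rewrite -(subKr (es (n - #|J|)) w); exact: (ideal_sub hW).
have nzd (f : R) : ~ weight_ideal J 1 f -> forall r, weight_ideal J 1 (f * r) -> weight_ideal J 1 r.
  by move=> hf r; case: hP => _ _ hM /hM [].
split; first by rewrite subn0; apply: nzd => /(is_prime_exp hP).
set fs := map _ _.
have regX i : i \notin J -> regular_seq (adjoin (@weight_ideal k n J 1) 'X_i) fs.
  move=> hi; apply: (@regular_seq_ext _ (weight_ideal (i |: J) 1)).
    by move=> r; rewrite adjoin_weight_ideal.
  have := IH (i |: J); rewrite cardsU1 hi add1n addnS => /(_ hc).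
  congr regular_seq; rewrite /fs (iotaDl 1 0) -map_comp; apply: eq_map => j /=.
  by congr (es _ ^+ _); lia.
have regw : regular_seq (adjoin (@weight_ideal k n J 1) w) fs.
  have -> : w = \prod_(g <- [seq 'X_i | i <- enum (~: J)]) g.
    rewrite big_map big_enum /= mprodXE; congr mpolyX; apply/mnmP => i.
    rewrite mnm_sumE mnmE -(wdegU (~: J) i) /wdeg.
    by apply: eq_bigr => j _; rewrite !mnm1E eq_sym.
  apply: regular_seq_prod => // g /mapP [i]; rewrite mem_enum inE => hi ->.
  by split; [apply: nzd; rewrite weight_ideal_XU; exact/negP | exact: regX].
(* The power w^a is once more a product of nonzerodivisors, and it is congruent to the a-th power of
   the symmetric polynomial modulo m_J. *)
have regwa : regular_seq (adjoin (@weight_ideal k n J 1) (w ^+ a)) fs.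
  have -> : w ^+ a = \prod_(g <- nseq a w) g.
    by elim: a {fs regX regw IH} => [|a IHa]; rewrite ?expr0 ?big_nil //= big_cons exprS IHa.
  apply: regular_seq_prod => // g /nseqP [-> _]; split=> //; exact: nzd.
have hwa : weight_ideal J 1 (es (n - #|J|) ^+ a - w ^+ a).
  by rewrite subrXX; apply: (ideal_mulr _ hW).
apply: regular_seq_ext regwa => r; rewrite subn0; split; apply: adjoin_congr => //.
by rewrite -opprB; apply: (ideal_opp hW).
Qed.

Lemma exp_weight_ideal J a b (f : R) :
  (b <= a)%N -> weight_ideal J 1 f -> weight_ideal J b (f ^+ a).
Proof.
move=> hb hf; have -> : f ^+ a = \prod_(i < a) f by rewrite prodr_const card_ord.
by move=> m /(weight_ideal_prod (fun=> hf)); apply: leq_trans.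
Qed.

(** For i < c <= |J|, the symmetric polynomial of degree n - i lies in m_J; raising it to the
    largest exponent puts it into every m_J^a at once. *)
Lemma regular_seq_weight_ideal (T : finType) (J : T -> {set 'I_n}) (a : T -> nat) c :
  (c <= n)%N -> (forall i, c <= #|J i|)%N ->
  exists fs : seq R, [/\ size fs = c, regular_seq (fun r => r = 0) fs
    & forall f, f \in fs -> forall i, weight_ideal (J i) (a i) f].
Proof.
move=> hcn hcJ; set b := (\max_i a i)%N.
exists (mkseq (fun i => es (n - #|set0 : {set 'I_n}| - i) ^+ b) c); split.
- exact: size_mkseq.
(* The zero ideal is m_J for J empty. *)
- apply: (@regular_seq_ext _ (weight_ideal set0 1)); last first.
    by apply: mesym_regular; rewrite cards0 addn0.
  move=> r; split=> [h|->]; last by move=> m; rewrite msupp0.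
  apply: msuppnil0; case e: (msupp r) => [|m s] //.
  by have := h m; rewrite e mem_head /wdeg big_set0 => /(_ isT).
- move=> f /mapP [i]; rewrite mem_iota /= => hi -> j.
  apply: exp_weight_ideal; first exact: (leq_bigmax j).
  by apply: mesym_weight_ideal; have := hcJ j; rewrite cards0; lia.
Qed.

End SymmetricRegular.

(** * Codimension *)

Section Counting.
Variable n : nat.
Local Notation mon := 'X_{1..n}.
Implicit Types (K : seq 'I_n) (V : {set 'I_n}) (m : mon).

(** The monomials of degree at most s in the variables of K, split by divisibility by x_j. The
    recursion is Pascal's rule, which yields the length at once. *)
Fixpoint mons K : nat -> seq mon :=
  if K is j :: K' then
    fix aux s := if s is s'.+1
      then mons K' s ++ [seq (m + U_(j))%MM | m <- aux s'] else mons K' 0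
  else fun=> [:: 0%MM].

Lemma monsS j K s :
  mons (j :: K) s.+1 = mons K s.+1 ++ [seq (m + U_(j))%MM | m <- mons (j :: K) s].
Proof. by []. Qed.

Lemma size_mons K s : size (mons K s) = 'C(s + size K, size K).
Proof.
elim: K s => [|j K IH] s; first by rewrite bin0.
elim: s => [|s IHs]; first by rewrite /= IH !add0n !binn.
by rewrite monsS size_cat size_map IH IHs /= !addnS !addSn [RHS]binS addnC.
Qed.

Lemma mem_mons K s m : uniq K ->
  (m \in mons K s) = (mdeg m <= s)%N && [forall i, (i \notin K) ==> (m i == 0%N)].
Proof.
elim: K s m => [|j K IH] s m.
  move=> _; rewrite inE; apply/eqP/andP => [->|[_ /forallP h]].
    by rewrite mdeg0; split=> //; apply/forallP => i; rewrite mnm0E.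
  by apply/mnmP => i; apply/eqP; rewrite mnm0E; apply: h.
rewrite cons_uniq => /andP [hj hK].
elim: s m => [|s IHs] m.
  rewrite [mons _ _]/= IH // leqn0 mdeg_eq0.
  case: eqP => //= ->; have vanish (K' : seq 'I_n) :
      [forall i, (i \notin K') ==> (0%MM i == 0%N :> nat)].
    by apply/forallP => i; rewrite mnm0E implybT.
  by rewrite !vanish.
rewrite monsS mem_cat IH //; case: (posnP (m j)) => hm.
  have -> : (m \in [seq (m0 + U_(j))%MM | m0 <- mons (j :: K) s]) = false.
    by apply/mapP => -[m' _ e]; move: hm; rewrite e mnmDE mnm1E eqxx addn1.
  rewrite orbF; congr andb; apply: eq_forallb => i; rewrite inE negb_or.
  by case: (i =P j) => // ->; rewrite hm hj.
have -> : [forall i, (i \notin K) ==> (m i == 0%N)] = false.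
  by apply/forallP => /(_ j); rewrite hj (negbTE (lt0n_neq0 hm)).
rewrite andbF /= {1}(mnm_decomp hm).
rewrite (mem_map (f := fun m' => (m' + U_(j))%MM) (@addIm _ _)) IHs.
congr andb.
  by rewrite {2}(mnm_decomp hm) mdegD mdeg1 addn1.
apply: eq_forallb => i; case: (i =P j) => [->|ne]; first by rewrite inE eqxx.
by rewrite mnmBE mnm1E; case: (j =P i) => [e|_]; [case: ne | rewrite subn0].
Qed.

Lemma mons_uniq K s : uniq K -> uniq (mons K s).
Proof.
elim: K s => [|j K IH] s //= /andP [hj hK].
elim: s => [|s IHs]; first exact: IH.
rewrite cat_uniq IH // map_inj_uniq ?IHs ?andbT; last exact: addIm.
apply/hasPn => _ /mapP [m _ ->]; rewrite /= mem_mons //.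
apply/negP => /andP [_ /forallP /(_ j)].
by rewrite hj mnmDE mnm1E eqxx addn1.
Qed.

Lemma mem_mons_set V s m :
  (m \in mons (enum V) s) = (mdeg m <= s)%N && (wdeg (~: V) m == 0%N).
Proof.
rewrite mem_mons ?enum_uniq //; congr andb; rewrite /wdeg sum_nat_eq0.
by apply: eq_forallb => i; rewrite mem_enum inE.
Qed.

Lemma size_mons_set V s : size (mons (enum V) s) = 'C(s + #|V|, #|V|).
Proof. by rewrite size_mons -cardE. Qed.

End Counting.

(** * Growth of quotients and heights of primes *)

Section Independence.
Variables (k : fieldType) (n : nat).
Local Notation R := {mpoly k[n]}.
Local Notation mon := 'X_{1..n}.
Implicit Types (A : R -> Prop) (L : seq mon).

Definition indep A N (B : 'I_N -> R) : Prop :=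
  forall u : 'I_N -> k, A (\sum_i u i *: B i) -> forall i, u i = 0.

(** A left kernel vector of the matrix of coefficients at L is a relation modulo A, so this matrix
    has full row rank. *)
Lemma indep_size A N (B : 'I_N -> R) L :
  (forall u : 'I_N -> k, {in L, forall m, (\sum_i u i *: B i)@_m = 0} ->
     A (\sum_i u i *: B i)) ->
  indep A B -> (N <= size L)%N.
Proof.
move=> hL hB; pose M : 'M[k]_(N, size L) := \matrix_(i, j) (B i)@_(nth 0%MM L j).
suff /eqP <- : row_free M by apply: rank_leq_col.
rewrite -kermx_eq0; apply/eqP/row_matrixP => i; rewrite row0.
have : row i (kermx M) *m M = 0 by rewrite -row_mul mulmx_ker row0.
set u := row i _ => hu; apply/rowP => j; rewrite [RHS]mxE.
apply: (hB (fun j => u 0 j)); apply: hL => m /(nthP 0%MM) [l hl <-].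
have := congr1 (fun X : 'rV_ _ => X 0 (Ordinal hl)) hu.
rewrite !mxE => <-; rewrite raddf_sum /=; apply: eq_bigr => q _.
by rewrite mcoeffZ [M _ _]mxE.
Qed.

Lemma indep_monomials (Q : pred mon) L : uniq L -> (forall m, m \in L -> ~~ Q m) ->
  indep (monomial_ideal Q) (fun i : 'I_(size L) => 'X_[nth 0%MM L i] : R).
Proof.
move=> hL hQ u hu i; set m := nth 0%MM L i.
have hm : ~~ Q m by apply: hQ; apply: mem_nth.
apply/eqP; rewrite -[_ == _]negbK; apply: contra hm => hi; apply: hu.
rewrite mcoeff_msupp raddf_sum /= (bigD1 i) //= mcoeffZ mcoeffX eqxx mulr1.
rewrite big1 ?addr0 // => j ne; rewrite mcoeffZ mcoeffX.
by rewrite nth_uniq // (negbTE ne : (j == i :> nat) = false) mulr0.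
Qed.

(* Certifies that R/A has dimension at least m. *)
Definition growth A m D : Prop := forall t, exists N (B : 'I_N -> R),
  [/\ N = 'C(t + m, m), forall i, (msize (B i) <= (D * t).+1)%N & indep A B].

(** Join f B, with B independent modulo A, to B' independent modulo A'. Reducing a relation modulo
    A', which contains f and A, kills the coefficients of B'; then f is cancelled modulo the prime
    A. The sizes add up by Pascal's rule. *)
Lemma growth_step A A' m D : is_prime A -> is_ideal A' -> ideal_lt A A' ->
  growth A' m D -> exists D', growth A m.+1 D'.
Proof.
move=> [hA h1 hM] hA' [hle hn] hg.
have [f [hf hfA]] : exists f, A' f /\ ~ A f.
  by apply: NNPP => h; apply: hn => f hf; apply: NNPP => hfA; apply: h; exists f.
(* Each increment of t multiplies the family by f once more, so the slope must absorb the size of f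
   as well as D. *)
exists (maxn D (msize f).+1); elim=> [|t [N [B [hN hB iB]]]].
  exists 1%N, (fun=> 1); split=> [|_|u]; first by rewrite binn.
    by rewrite msize1.
  rewrite big_ord1 => hu i; rewrite ord1; apply/eqP; rewrite -[_ == _]negbK.
  apply/negP => h0; apply: h1; case: hA => _ _ /(_ ((u ord0)^-1)%:MP _ hu).
  by rewrite mul_mpolyC scalerA mulVf // scale1r.
have [N' [B' [hN' hB' iB']]] := hg t.+1.
exists (N + N')%N, (fun i => match split i with
  inl j => f * B j | inr j => B' j end); split.
- by rewrite hN hN' !addSn !addnS [RHS]binS.
- move=> i; case: (split i) => j.
    apply: leq_trans (msizeM_le _ _) _; have := hB j.
    by have := leq_maxr D (msize f).+1; nia.
  apply: leq_trans (hB' j) _.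
  by rewrite ltnS leq_mul2r leq_maxl orbT.
- move=> u hu.
  have e1 : \sum_i u i *: (match split i with inl j => f * B j | inr j => B' j end)
      = f * (\sum_j u (lshift N' j) *: B j) + \sum_j u (rshift N j) *: B' j.
    rewrite big_split_ord /=; congr (_ + _).
      rewrite mulr_sumr; apply: eq_bigr => j _.
      by have := unsplitK (inl j : 'I_N + 'I_N') => /= ->; rewrite scalerAr.
    by apply: eq_bigr => j _; have := unsplitK (inr j : 'I_N + 'I_N') => /= ->.
  rewrite e1 in hu.
  have hr j : u (rshift N j) = 0.
    apply: (iB' (fun j => u (rshift N j))); have := ideal_sub hA' (hle _ hu).
    move=> /(_ (f * (\sum_j u (lshift N' j) *: B j))).
    by rewrite addrAC subrr add0r; apply; apply: ideal_mulr.
  rewrite [X in _ + X]big1 ?addr0 in hu; last by move=> j _; rewrite hr scale0r.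
  have hl j : u (lshift N' j) = 0.
    by apply: (iB (fun j => u (lshift N' j))); case: (hM _ _ hu).
  by move=> i; case: (split_ordP i) => j ->.
Qed.

(** There are only C(D t + n, n) monomials of degree at most D t, a quantity of order t^n, whereas m
    > n would give families of order at least t^(n+1). *)
Lemma growth_bound A m D : is_ideal A -> growth A m D -> (m <= n)%N.
Proof.
move=> hA hg; rewrite leqNgt; apply/negP => hnm.
have hb t : ('C(t + n.+1, n.+1) <= 'C(D * t + n, n))%N.
  have [N [B [hN hB iB]]] := hg t.
  have : (N <= size (mons (enum [set: 'I_n]) (D * t)))%N.
    apply: indep_size iB => u hu; suff -> : \sum_i u i *: B i = 0 by case: hA.
    apply/mpolyP => p; rewrite mcoeff0.
    case: (leqP (mdeg p) (D * t)) => hp.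
      by apply: hu; rewrite mem_mons_set hp /= /wdeg setCT big_set0.
    rewrite raddf_sum /= big1 // => i _; rewrite mcoeffZ.
    rewrite (memN_msupp_eq0 (msize_mdeg_ge _)) ?mulr0 //.
    exact: leq_trans (hB i) hp.
  rewrite size_mons_set cardsT card_ord hN; apply: leq_trans.
  have sym p : 'C(t + p, p) = 'C(t + p, t).
    by rewrite -(bin_sub (leq_addl t p)) addnK.
  by rewrite !sym; apply: leq_bin2l; rewrite leq_add2l.
have lower t : (t ^ n.+1 <= 'C(t + n.+1, n.+1) * n.+1`!)%N.
  rewrite bin_ffact; elim: n.+1 => [|p IH]; first by rewrite expn0.
  rewrite expnS addnS ffactnS /=; apply: leq_mul => //.
  by rewrite leqW // leq_addr.
have upper q : ('C(q + n, n) * n`! <= (q + n) ^ n)%N.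
  rewrite bin_ffact; elim: {2 4}n => [|p IH]; first by [].
  by rewrite ffactnSr expnSr leq_mul // leq_subr.
(* Large enough that D t + n <= (D + 1) t when n > 0, and that t^(n+1) exceeds (n + 1) ((D + 1)
   t)^n. *)
set t := ((n.+1 * D.+1 ^ n).+1)%N.
have : (t ^ n.+1 <= n.+1 * (D.+1 * t) ^ n)%N.
  apply: leq_trans (lower t) _.
  rewrite factS mulnCA leq_mul2l /=; apply: leq_trans (leq_mul (hb t) (leqnn _)) _.
  apply: leq_trans (upper _) _; case: (posnP n) => [->|hn]; first by [].
  rewrite leq_exp2r // mulSn addnC leq_add2r /t.
  apply: leqW; rewrite -[X in (X <= _)%N]muln1; apply: leq_mul => //.
  by rewrite expn_gt0.
rewrite expnMn mulnA expnS leq_pmul2r ?expn_gt0 //.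
by rewrite /t ltnn.
Qed.

(** The monomials in the variables outside J give growth exponent n - |J|. Going down the chain
    raises it to n - |J| + h, which is at most n. *)
Lemma chain_length J h : prime_chain (@weight_ideal k n J 1) h -> (h <= #|J|)%N.
Proof.
case=> Q [hp hlt hQ].
have gP : growth (@weight_ideal k n J 1) (n - #|J|) 1.
  move=> t; exists (size (mons (enum (~: J)) t)),
    (fun i => 'X_[nth 0%MM (mons (enum (~: J)) t) i]); split.
  - rewrite size_mons_set; suff -> : #|~: J| = (n - #|J|)%N by [].
    have e : (#|J| + #|~: J| = n)%N by rewrite cardsC card_ord.
    by rewrite -[LHS](addKn #|J|) e.
  - move=> i; rewrite msizeX ltnS mul1n.
    have := mem_nth 0%MM (ltn_ord i); rewrite mem_mons_set.
    by case/andP.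
  - apply: indep_monomials; first by rewrite mons_uniq ?enum_uniq.
    by move=> m; rewrite mem_mons_set setCK -leqNgt => /andP [_ /eqP ->].
have gQ i : (i <= h)%N -> exists D, growth (Q (h - i)%N) (n - #|J| + i) D.
  elim: i => [|i IH] hi.
    exists 1%N => t; have [N [B [e1 e2 iB]]] := gP t; exists N, B.
    by rewrite addn0; split=> // u; rewrite subn0 => /hQ /iB.
  have [D hD] := IH (ltnW hi); rewrite addnS.
  have e : (h - i = (h - i.+1).+1)%N by lia.
  rewrite e in hD; apply: growth_step hD; first by apply: hp; lia.
    by case: (hp (h - i.+1).+1%N) => //; lia.
  by apply: hlt; lia.
have [D hD] := gQ h (leqnn h).
have [hI _ _] := hp 0 (leq0n h).
rewrite subnn in hD; have := growth_bound hI hD.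
have : (#|J| <= n)%N by rewrite -[X in (_ <= X)%N]card_ord max_card.
lia.
Qed.

(** Adjoin the variables of J one at a time, starting from the zero ideal, and put P in place of the
    last member m_J. *)
Lemma chain_exists J (P : R -> Prop) : is_prime P ->
  ideal_le (@weight_ideal k n J 1) P -> prime_chain P #|J|.
Proof.
move=> hP hle; pose Js i := [set x in take i (enum J)].
have sizeJ : size (enum J) = #|J| by rewrite -cardE.
exists (fun i => if (i < #|J|)%N then weight_ideal (Js i) 1 else P); split.
- by move=> i _; case: ifP => _ //; apply: is_prime_weight_ideal.
- move=> i hi; rewrite hi.
  have x0 : 'I_n by case: (enum J) sizeJ hi => [<- //|x].
  set x := nth x0 (enum J) i.
  have hx : x \in J by rewrite -mem_enum mem_nth ?sizeJ.
  have x_notin : ~ weight_ideal (Js i) 1 ('X_x : R).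
    rewrite weight_ideal_XU inE => /(nthP x0) [j]; rewrite size_takel ?sizeJ ?(ltnW hi) // => hj.
    rewrite nth_take // => /eqP; rewrite nth_uniq ?enum_uniq ?sizeJ //; last exact: ltn_trans hi.
    by rewrite ltn_eqF.
  have mono (J1 J2 : {set 'I_n}) : J1 \subset J2 ->
      ideal_le (@weight_ideal k n J1 1) (weight_ideal J2 1).
    move=> /subsetP hs f hf m /hf /wdeg_gt0P [j hj hm].
    by apply/wdeg_gt0P; exists j => //; apply: hs.
  case: ifP => hi1; split.
  + apply: mono; apply/subsetP => y; rewrite !inE => /(nthP x0) [j].
    rewrite size_takel ?sizeJ ?(ltnW hi) // => hj <-; apply/(nthP x0); exists j.
      by rewrite size_takel ?sizeJ // ltnW.
    by rewrite !nth_take // ltnW.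
  + move=> h; apply: x_notin; apply: h; apply/weight_ideal_XU; rewrite inE.
    apply/(nthP x0); exists i.
      by rewrite size_takel ?sizeJ.
    by rewrite nth_take.
  + move=> f hf; apply: hle; move: f hf; apply: mono; apply/subsetP => y; rewrite inE => /mem_take.
    by rewrite mem_enum.
  + by move=> h; apply: x_notin; apply: h; apply: hle; apply/weight_ideal_XU.
- by move=> f; rewrite ltnn.
Qed.

Lemma height_weight_ideal J : prime_height (@weight_ideal k n J 1) #|J|.
Proof.
split; last exact: chain_length.
by apply: chain_exists => //; apply: is_prime_weight_ideal.
Qed.

(** A prime P containing I contains some m_(J_i): otherwise pick in each J_i a variable outside P;
    the product of their powers with exponents a_i lies in I but not in P. The height of P is then
    at least |J_i|. *)
Lemma codim_intersection s (J : 'I_s -> {set 'I_n}) (a : 'I_s -> nat) (I : R -> Prop) c :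
  (0 < s)%N -> (forall i, 0 < a i)%N ->
  (forall f, I f <-> forall i, weight_ideal (J i) (a i) f) -> codim I c ->
  (exists i, #|J i| = c) /\ forall i, (c <= #|J i|)%N.
Proof.
move=> hs ha hI [[P [hP hIP hPc]] hmin].
have hle i : (c <= #|J i|)%N.
  apply: hmin (height_weight_ideal (J i)); first exact: is_prime_weight_ideal.
  by move=> f /hI /(_ i) hf m /hf; apply: leq_trans.
suff [i hi] : exists i, ideal_le (@weight_ideal k n (J i) 1) P.
  split=> //; exists i; apply/eqP; rewrite eqn_leq hle andbT.
  by case: hPc => _; apply; apply: chain_exists.
apply: NNPP => hn.
have /fin_all_exists [x hx] : forall i, exists j, j \in J i /\ ~ P ('X_j).
  move=> i; apply: NNPP => h; apply: hn; exists i => f.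
  apply: monomial_ideal_ideal; first by case: hP.
  move=> m /wdeg_gt0P [j hj /mnm_decomp ->]; rewrite mpolyXD.
  have [[_ _ hM] _ _] := hP; apply: hM; apply: NNPP => hj'.
  by apply: h; exists j.
have : P (\prod_i 'X_(x i) ^+ a i).
  apply: hIP; apply/hI => i; apply: (ideal_prod (i := i) (@is_ideal_weight_ideal _ _ _ _)).
  by rewrite mpolyXn; apply/monomial_idealX; rewrite wdegMn wdegU (hx i).1 mul1n.
case/(is_prime_prod hP) => i /(is_prime_exp hP).
exact: (hx i).2.
Qed.

End Independence.

(** * Multiplicity *)

Section LeadingCoefficients.
Implicit Types (p q : {poly rat}) (g t : nat).

Lemma poly_pos_eventually p : 0 < lead_coef p ->
  exists (N : nat) (d : rat), 0 < d /\ forall t, (N <= t)%N -> d <= p.[t%:R].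
Proof.
elim/poly_ind: p => [|q c IH]; first by rewrite lead_coef0 ltxx.
have [->|q0] := eqVneq q 0.
  rewrite mul0r add0r lead_coefC => hc; exists 0%N, c; split=> // t _.
  by rewrite hornerC.
have -> : lead_coef (q * 'X + c%:P) = lead_coef q.
  rewrite lead_coefDl ?lead_coefMX // size_mulX // size_polyC.
  by apply: leq_ltn_trans (leq_b1 _) _; rewrite ltnS size_poly_gt0.
(* With q >= d > 0 eventually, t q + c >= d as soon as t >= |d - c| / d. *)
move=> /IH [N [d [hd hN]]]; set x := `|d - c| / d.
have hx : x < (Num.bound x)%:R by apply: archi_boundP; apply: divr_ge0; rewrite ?normr_ge0 // ltW.
exists (maxn N (Num.bound x)), d; split=> // t; rewrite geq_max => /andP [/hN h1 h2].
have hxt : x <= t%:R by apply: le_trans (ltW hx) _; rewrite ler_nat.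
have h3 : `|d - c| <= t%:R * d by rewrite -ler_pdivrMr.
have h4 : d * t%:R <= q.[t%:R] * t%:R by rewrite ler_wpM2r ?ler0n.
rewrite !hornerE; have h5 := ler_norm (d - c); move: h3 h4 h5.
set y := t%:R. set z := q.[y]. set w := `|_|. lra.
Qed.

Lemma lead_coef_ge0 p (N : nat) :
  (forall t, (N <= t)%N -> 0 <= p.[t%:R]) -> 0 <= lead_coef p.
Proof.
move=> h; rewrite leNgt; apply/negP => hp.
have [|N' [d [hd hN']]] := @poly_pos_eventually (- p).
  by rewrite lead_coefN oppr_gt0.
have := hN' (maxn N N') (leq_maxr _ _); have := h (maxn N N') (leq_maxl _ _).
rewrite hornerN; lra.
Qed.

Lemma poly_eventually0 p (N : nat) :
  (forall t, (N <= t)%N -> p.[t%:R] = 0) -> p = 0.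
Proof.
move=> h; apply/eqP; rewrite -lead_coef_eq0 eq_le; apply/andP; split.
  rewrite -oppr_ge0 -lead_coefN; apply: (@lead_coef_ge0 _ N) => t /h.
  by rewrite hornerN => ->; rewrite oppr0.
by apply: (@lead_coef_ge0 _ N) => t /h ->.
Qed.

Fixpoint bin_poly g : {poly rat} :=
  if g is g'.+1 then (g%:R^-1)%:P * (('X + g%:R%:P) * bin_poly g') else 1.

Lemma bin_polyE g t : (bin_poly g).[t%:R] = 'C(t + g, g)%:R.
Proof.
elim: g => [|g IH]; first by rewrite hornerC bin0.
rewrite /= hornerM hornerC hornerM hornerD hornerX hornerC IH -natrD -natrM addnS.
by rewrite (mul_bin_diag (t + g).+1) natrM mulKf // pnatr_eq0.
Qed.

Lemma size_bin_poly g : size (bin_poly g) = g.+1 /\ lead_coef (bin_poly g) = (g`!%:R)^-1.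
Proof.
elim: g => [|g [IH1 IH2]]; first by rewrite size_poly1 lead_coef1 invr1.
have nz : (g.+1%:R : rat) != 0 by rewrite pnatr_eq0.
have nz' : bin_poly g != 0 by rewrite -size_poly_eq0 IH1.
split; rewrite /= mul_polyC.
  rewrite size_scale ?invr_eq0 // size_mul // ?IH1 ?size_XaddC //.
  by rewrite -size_poly_eq0 size_XaddC.
rewrite lead_coefZ lead_coefM IH2 lead_coefXaddC mul1r -invfM -natrM.
by rewrite factS.
Qed.

(* Only the order of growth matters: [(t + 1)] is factored out of the second
   bound so that the error term has degree below that of the main term. *)
Lemma lead_coef_squeeze p g (E K N : nat) :
  (forall t, (N <= t)%N -> 'C(t + g, g)%:R <= p.[t%:R]) ->
  (forall t, (N <= t)%N ->
     t.+1%:R * p.[t%:R] <= (E * t.+1 * 'C(t + g, g) + K * t.+1 ^ g)%:R) ->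
  p != 0 /\ (size p).-1`!%:R * lead_coef p <= E%:R.
Proof.
move=> hlo hup; have [sB lB] := size_bin_poly g.
have fpos : 0 < (g`!%:R : rat) by rewrite ltr0n fact_gt0.
have hsz : (g < size p)%N.
  rewrite ltnNge; apply/negP => hs.
  have : 0 <= lead_coef (p - bin_poly g).
    by apply: (@lead_coef_ge0 _ N) => t /hlo h; rewrite !hornerE bin_polyE; lra.
  rewrite addrC lead_coefDl ?size_polyN ?sB //.
  by rewrite lead_coefN lB oppr_ge0 leNgt invr_gt0 fpos.
have p0 : p != 0 by rewrite -size_poly_gt0; apply: leq_trans hsz.
split=> //.
have lp : 0 < lead_coef p.
  rewrite lt_neqAle eq_sym lead_coef_eq0 p0; apply: (@lead_coef_ge0 _ N) => t /hlo.
  by apply: le_trans; rewrite ler0n.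
set X1 : {poly rat} := 'X + 1%:P.
have sX1 : size X1 = 2%N by rewrite size_XaddC.
have lX1 : lead_coef X1 = 1 by rewrite lead_coefXaddC.
have X10 : X1 != 0 by rewrite -size_poly_eq0 sX1.
have sX1g : size (X1 ^+ g) = g.+1.
  have := size_exp X1 g; rewrite sX1 mul1n => {2}<-.
  by rewrite prednK // size_poly_gt0 expf_neq0.
set D := E%:R *: bin_poly g - p.
have hD : 0 <= lead_coef (X1 * D + K%:R *: X1 ^+ g).
  apply: (@lead_coef_ge0 _ N) => t /hup.
  rewrite /D !hornerE bin_polyE !natrD !natrM natrX -[t.+1]addn1 natrD; lra.
(* When D has degree at least g, the error term K (X + 1)^g has smaller degree than (X + 1) D and
   cannot offset a negative leading coefficient. *)
have neg : (g < size D)%N -> lead_coef D < 0 -> False.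
  move=> hs hl; move: hD; rewrite lead_coefDl.
    by rewrite lead_coefM lX1 mul1r leNgt hl.
  apply: leq_ltn_trans (size_scale_leq _ _) _; rewrite sX1g.
  rewrite size_mul // ?sX1 ?ltnS //.
  by rewrite -size_poly_gt0; apply: leq_trans hs.
have sEB : (size (E%:R *: bin_poly g) <= g.+1)%N by rewrite -sB size_scale_leq.
have sp : size p = g.+1.
  apply/eqP; rewrite eqn_leq hsz andbT leqNgt; apply/negP => hs.
  have e : size (- p) = size p by rewrite size_polyN.
  apply: neg; rewrite /D addrC.
    by rewrite size_polyDl e // (leq_ltn_trans sEB).
  by rewrite lead_coefDl ?e ?(leq_ltn_trans sEB) // lead_coefN oppr_lt0.
have cD : D`_g = E%:R / g`!%:R - lead_coef p.
  by rewrite coefB coefZ -lB lead_coefE sB lead_coefE sp.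
rewrite sp /= leNgt; apply/negP => hlt.
have cneg : D`_g < 0.
  by rewrite cD subr_lt0 ltr_pdivrMr // mulrC.
have sD : size D = g.+1.
  apply/eqP; rewrite eqn_leq; apply/andP; split; last first.
    by rewrite ltnNge; apply/negP => /leq_sizeP /(_ g (leqnn g)) e; move: cneg; rewrite e ltxx.
  by apply: leq_trans (size_polyD _ _) _; rewrite size_polyN geq_max sEB sp ltnSn.
by apply: neg; rewrite ?lead_coefE sD.
Qed.

End LeadingCoefficients.

(** * Inequalities for multiset coefficients *)

Section MultisetCoefficients.
Implicit Types (a b c : nat).

(* The number of multisets of size c on a letters; 0 - 1 = 0 makes the value
   at a = c = 0 correct. *)
Definition multichoose a c : nat := 'C((a + c).-1, c).

Lemma multichooseS a c : (c.+1 * multichoose a c.+1 = (a + c) * multichoose a c)%N.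
Proof. by rewrite /multichoose addnS /= -mul_bin_diag. Qed.

Lemma multichoose_mono a b c : (a <= b)%N -> (multichoose a c <= multichoose b c)%N.
Proof. by move=> h; apply: leq_bin2l; lia. Qed.

Lemma multichoose1 a : multichoose a 1 = a.
Proof. by rewrite /multichoose addn1 bin1. Qed.

Lemma multichoose_fact a c : (multichoose a c * c`! = \prod_(1 <= i < c.+1) (a + i.-1))%N.
Proof.
elim: c => [|c IH]; first by rewrite big_geq // /multichoose bin0.
by rewrite big_nat_recr //= -IH factS mulnA [(_ * c.+1)%N]mulnC multichooseS -mulnA mulnC.
Qed.

Lemma multichoose_add a b c : (0 < b)%N -> (b <= a)%N ->
  (multichoose a c + c * multichoose b c <= multichoose (a + b) c)%N.
Proof.
move=> hb hba; elim: c => [|c IH]; first by rewrite /multichoose !bin0.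
rewrite -(leq_pmul2l (ltn0Sn c)) mulnDr !multichooseS.
(* With A and B the values of [multichoose] at a and b, the induction hypothesis leaves b A + (c a -
   b - c) B >= 0, and A >= B bounds this below by c (a - 1) B. *)
have := multichoose_mono c hba; nia.
Qed.

(** Let x maximize A on S and y maximize it on the rest. The at most c remaining terms are each
    bounded by the one at y, so [multichoose_add] applies with A x + A y <= M. *)
Lemma sum_multichoose_le (T : finType) (S : {set T}) (A : T -> nat) c M :
  (forall x, x \in S -> 0 < A x <= M)%N ->
  {in S &, forall x y, x != y -> A x + A y <= M}%N ->
  (#|S| <= c.+1)%N ->
  (\sum_(x in S) multichoose (A x) c <= multichoose M c)%N.
Proof.
move=> hA hM hc.
have [->|[x0 hx0]] := set_0Vmem S; first by rewrite big_set0.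
case: (arg_maxnP A hx0) => x hxS xmax; have hx : x \in S := hxS.
rewrite (big_setD1 x) //=.
have [->|[y0 hy0]] := set_0Vmem (S :\ x).
  by rewrite big_set0 addn0 multichoose_mono //; case/andP: (hA x hx).
case: (arg_maxnP A hy0) => y hy ymax.
have /setD1P [hyx hyS] : y \in S :\ x := hy.
have cS : (#|S :\ x| <= c)%N by move: hc; rewrite (cardsD1 x) hx.
have : (\sum_(z in S :\ x) multichoose (A z) c <= c * multichoose (A y) c)%N.
  apply: (@leq_trans (\sum_(z in S :\ x) multichoose (A y) c)).
    by apply: leq_sum => z hz; apply: multichoose_mono; apply: ymax.
  by rewrite sum_nat_const leq_mul2r cS orbT.
have := @multichoose_add (A x) (A y) c; have := multichoose_mono c (hM x y hx hyS _).
rewrite eq_sym => /(_ hyx) h1 h2 h3.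
apply: leq_trans h1; apply: leq_trans (h2 _ _); first by rewrite leq_add2l.
  by case/andP: (hA y hyS).
exact: xmax.
Qed.

End MultisetCoefficients.

(** * Hilbert functions of monomial ideals *)

Section HilbertFunction.
Variables (k : fieldType) (n : nat).
Local Notation R := {mpoly k[n]}.
Local Notation mon := 'X_{1..n}.
Implicit Types (X : {set 'I_n}) (m : mon) (L : seq mon) (Q : pred mon).

Lemma hilbert_le (I : R -> Prop) Q H t L :
  (forall f, I f <-> monomial_ideal Q f) -> hilbert_function I H ->
  (forall m, mdeg m = t -> ~~ Q m -> m \in L) -> (H t <= size L)%N.
Proof.
move=> hI /(_ t) [B [hB iB _]] hL; apply: indep_size iB => u hu.
apply/hI => m hm; apply: contraT => hQ.
have hu' : \sum_i u i *: B i \is t.-homog.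
  by apply: rpred_sum => i _; apply: dhomogZ.
have hd : mdeg m = t := dhomog_mf hu' hm.
by move: hm; rewrite mcoeff_msupp hu ?eqxx //; apply: hL.
Qed.

(** Express the monomials of L in the basis B: a left kernel vector of the resulting matrix is a
    relation between these monomials modulo I, hence zero. *)
Lemma hilbert_ge (I : R -> Prop) Q H t L :
  (forall f, I f <-> monomial_ideal Q f) -> up_closed Q -> hilbert_function I H -> uniq L ->
  (forall m, m \in L -> mdeg m = t /\ ~~ Q m) -> (size L <= H t)%N.
Proof.
move=> hI hQ /(_ t) [B [hB iB sB]] hu hL.
have hid := @is_ideal_monomial_ideal k n Q hQ.
pose x (i : 'I_(size L)) : R := 'X_[nth 0%MM L i].
have /fin_all_exists [U hU] i : exists v : 'I_(H t) -> k, I (x i - \sum_j v j *: B j).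
  by apply: sB; rewrite dhomogX; have [/eqP] := hL _ (mem_nth 0%MM (ltn_ord i)).
pose M := \matrix_(i, j) U i j.
suff /eqP <- : row_free M by apply: rank_leq_col.
rewrite -kermx_eq0; apply/eqP/row_matrixP => i; rewrite row0.
have : row i (kermx M) *m M = 0 by rewrite -row_mul mulmx_ker row0.
set w := row i _ => hw; apply/rowP => j; rewrite [RHS]mxE.
apply: (@indep_monomials k n Q L hu _ (fun j => w 0 j)) => [m /hL [] //|].
have -> : \sum_i w 0 i *: x i = \sum_i w 0 i *: (x i - \sum_j U i j *: B j).
  rewrite [RHS](eq_bigr (fun i => w 0 i *: x i - w 0 i *: \sum_j U i j *: B j)); last first.
    by move=> l _; rewrite scalerBr.
  rewrite sumrB [X in _ - X](_ : _ = 0) ?subr0 //.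
  under eq_bigr do rewrite scaler_sumr.
  rewrite exchange_big big1 //= => l _.
  under eq_bigr do rewrite scalerA.
  rewrite -scaler_suml; have := congr1 (fun Y : 'rV_ _ => Y 0 l) hw.
  rewrite !mxE => e; rewrite -[RHS](scale0r (B l)); congr (_ *: _); apply: etrans e.
  by apply: eq_bigr => q _; rewrite [M _ _]mxE.
apply: ideal_sum => // l _; rewrite -mul_mpolyC.
by have [_ _] := hid; apply; apply/hI.
Qed.

Definition mrestr X m : mon := [multinom (if i \in X then m i else 0%N) | i < n].

Lemma wdeg_mrestr X Y m : wdeg Y (mrestr X m) = wdeg (Y :&: X) m.
Proof.
rewrite /wdeg [RHS](eq_bigl (fun i => (i \in Y) && (i \in X))); last first.
  by move=> i; rewrite inE.
by rewrite big_mkcondr; apply: eq_bigr => i _; rewrite mnmE.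
Qed.

Lemma mdeg_mrestr X m : mdeg (mrestr X m) = wdeg X m.
Proof. by rewrite -wdegT wdeg_mrestr setTI. Qed.

Lemma mrestr_mons X m s : (wdeg X m <= s)%N -> mrestr X m \in mons (enum X) s.
Proof.
move=> h; rewrite mem_mons_set mdeg_mrestr h wdeg_mrestr setIC setICr.
by rewrite /wdeg big_set0.
Qed.

(** Lists at least the monomials of degree t and X-degree below A: m1 is the part in X, m2 the part
    outside X and j, and x_j fills up the degree. Truncated subtraction may add entries of degree
    above t, which is harmless for an upper bound. *)
Definition cover X j A t : seq mon :=
  [seq (m1 + m2 + U_(j) *+ (t - mdeg m1 - mdeg m2))%MM
    | m1 <- mons (enum X) A.-1, m2 <- mons (enum (~: X :\ j)) t].

Lemma card_setC_D1 X j : j \notin X -> #|~: X :\ j| = (n - #|X|).-1.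
Proof.
move=> hj; have : #|~: X| = #|~: X :\ j|.+1 by rewrite (cardsD1 j) inE hj.
have : (#|X| + #|~: X| = n)%N by rewrite cardsC card_ord.
by move=> e1 e2; rewrite -[X in (X - _)%N]e1 addKn e2.
Qed.

Lemma size_cover X j A t : j \notin X -> (0 < A)%N ->
  size (cover X j A t) = (multichoose A #|X| * 'C(t + (n - #|X|).-1, (n - #|X|).-1))%N.
Proof.
move=> hj hA; rewrite size_allpairs !size_mons_set card_setC_D1 //.
by congr ('C(_, _) * _)%N; lia.
Qed.

Lemma mem_cover X j A t m : j \notin X ->
  mdeg m = t -> (wdeg X m < A)%N -> m \in cover X j A t.
Proof.
move=> hj ht hw; apply/allpairsP; exists (mrestr X m, mrestr (~: X :\ j) m) => /=.
have hsum := wdegC X m.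
have e : wdeg (~: X) m = (m j + wdeg (~: X :\ j) m)%N.
  by rewrite /wdeg (big_setD1 j) //= inE.
split; [by apply: mrestr_mons; lia | by apply: mrestr_mons; lia |].
rewrite !mdeg_mrestr; apply/mnmP => i; rewrite !mnmDE mulmnE !mnmE !inE.
case: (eqVneq i j) => [->|ne]; first by rewrite (negbTE hj) /=; lia.
by case: (i \in X) => /=; lia.
Qed.

Lemma bin_le_exp t q : ('C(t + q, q) <= t.+1 ^ q)%N.
Proof.
elim: q => [|q IH]; first by rewrite bin0.
rewrite -(leq_pmul2l (ltn0Sn q)) -(mul_bin_diag (t + q.+1)) addnS /= expnS mulnA.
by apply: leq_mul => //; nia.
Qed.

End HilbertFunction.

(** * Multiplicity and shifts of an intersection of powers *)

Section IntersectionIdeal.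
Variables (k : fieldType) (n s : nat).
Local Notation R := {mpoly k[n]}.
Local Notation mon := 'X_{1..n}.
Variables (J : 'I_s -> {set 'I_n}) (a : 'I_s -> nat).
Hypothesis a_gt0 : forall i, (0 < a i)%N.
Variable I : R -> Prop.
Hypothesis hI : forall f, I f <-> forall i, weight_ideal (J i) (a i) f.
Variable c : nat.
Hypotheses (c_max : forall i, (c <= #|J i|)%N) (c_att : exists i, #|J i| = c).
Implicit Types (X Y : {set 'I_n}) (m : mon).

Definition inI m : bool := [forall i, (a i <= wdeg (J i) m)%N].

Lemma inI_up : up_closed inI.
Proof.
move=> m m' /forallP h; apply/forallP => i; rewrite wdegD.
exact: leq_trans (h i) (leq_addl _ _).
Qed.

Lemma I_monomial_ideal f : I f <-> monomial_ideal inI f.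
Proof.
rewrite hI; split=> [h m hm|h i m /h /forallP //].
by apply/forallP => i; apply: h.
Qed.

(** Indices with equal J_i are merged here; [comp_exp] keeps the largest exponent, since m_J^a
    decreases with a. *)
Definition comps : {set {set 'I_n}} := [set J i | i : 'I_s].

Definition top_comps := [set X in comps | #|X| == c].

Definition comp_exp X : nat := \max_(i | J i == X) a i.

Lemma comp_exp_ge i : (a i <= comp_exp (J i))%N.
Proof. by rewrite /comp_exp; apply: (bigop.leq_bigmax_cond (F := a)). Qed.

Lemma comp_exp_gt0 X : X \in comps -> (0 < comp_exp X)%N.
Proof. by case/imsetP => i _ ->; apply: leq_trans (comp_exp_ge i). Qed.

Lemma comp_exp_le m X : X \in comps -> inI m -> (comp_exp X <= wdeg X m)%N.
Proof.
move=> hX /forallP h; apply/bigmax_leqP => i /eqP <-; exact: h.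
Qed.

Lemma not_inI m : ~~ inI m -> exists2 X, X \in comps & (wdeg X m < comp_exp X)%N.
Proof.
rewrite negb_forall => /existsP [i]; rewrite -ltnNge => hi.
exists (J i); first exact: imset_f.
exact: leq_trans hi (comp_exp_ge i).
Qed.

Definition mult_bound : nat := (\sum_(X in top_comps) multichoose (comp_exp X) c)%N.

(** Every J_i is [n], so I is a power of the maximal ideal, the Hilbert polynomial is zero and e
    counts monomials of degree below the exponent. *)
Lemma mult_le_artinian e : c = n -> multiplicity I e -> e <= mult_bound%:R.
Proof.
move=> hc [H [P [N [hH hP ->]]]].
have compT X : X \in comps -> X = setT.
  case/imsetP => i _ ->; apply/eqP; rewrite eqEcard subsetT cardsT card_ord.
  by rewrite -[X in (X <= _)%N]hc c_max.
set A := comp_exp setT; set L := mons (enum [set: 'I_n]) A.-1.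
have hle t : (H t <= count (fun m => mdeg m == t) L)%N.
  rewrite -size_filter; apply: (hilbert_le I_monomial_ideal hH) => m hm /not_inI [X /compT ->].
  rewrite wdegT -/A mem_filter hm eqxx mem_mons_set /wdeg setCT big_set0 eqxx andbT.
  by lia.
have P0 : P = 0.
  apply: (@poly_eventually0 _ (maxn N A)) => t; rewrite geq_max => /andP [hN hA].
  rewrite -hP //; suff -> : H t = 0%N by [].
  apply/eqP; rewrite -leqn0 (leq_trans (hle t)) // leqn0 -leqn0 -ltnS.
  rewrite ltnNge -has_count; apply/hasPn => m; rewrite mem_mons_set => /andP [hm _].
  have : (0 < A)%N.
    by case: (c_att) => i _; rewrite /A -(compT (J i)) ?comp_exp_gt0 ?imset_f.
  by move=> A0 /=; apply/eqP; lia.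
rewrite P0 eqxx ler_nat; apply: (@leq_trans (size L)).
  apply: (@leq_trans (\sum_(t < N) count (fun m => mdeg m == t) L)).
    exact: leq_sum.
  elim: L {hle} => [|m L IH] /=; first by rewrite big1.
  rewrite big_split /= -add1n; apply: leq_add IH.
  have [hm|hm] := ltnP (mdeg m) N.
    by rewrite (bigD1 (Ordinal hm)) //= eqxx big1 // => t; rewrite -val_eqE /= eq_sym => /negbTE ->.
  rewrite big1 // => t _; case: eqP => // em; move: (ltn_ord t); lia.
have [i hi] := c_att.
have hT : setT \in top_comps.
  by rewrite inE cardsT card_ord hc eqxx andbT -(compT (J i)) ?imset_f.
rewrite /mult_bound (big_setD1 _ hT) /=; apply: leq_trans (leq_addr _ _).
have A0 : (0 < A)%N by apply: comp_exp_gt0; move: hT; rewrite inE => /andP [].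
rewrite size_mons_set cardsT card_ord hc -/A /multichoose.
by apply: leq_bin2l; lia.
Qed.

(** Monomials avoiding one J_i of size c bound H from below by C(t + g, g). From above, the
    monomials outside I are covered component by component; components larger than c have lower
    order and go into K. *)
Lemma mult_le_positive_dim e : (c < n)%N -> multiplicity I e -> e <= mult_bound%:R.
Proof.
move=> hc [H [P [N [hH hP ->]]]]; set g := (n - c).-1.
pose K := (\sum_(X in comps :\: top_comps) multichoose (comp_exp X) #|X|)%N.
pose N' := maxn N (comp_exp setT).
(* Beyond N' a component equal to [n], which leaves no variable j for [cover], excludes no monomial
   of degree t. *)
suff [p0] : P != 0 /\ (size P).-1`!%:R * lead_coef P <= mult_bound%:R.
  by rewrite (negbTE p0).
apply: (@lead_coef_squeeze P g mult_bound K N') => t; rewrite geq_max => /andP [hN hT].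
  rewrite -hP // ler_nat; have [i0 hi0] := c_att.
  have /subsetPn [j0 _ hj0] : ~~ ([set: 'I_n] \subset J i0).
    apply/negP => /subset_leq_card; rewrite cardsT card_ord hi0; lia.
  (* The variable j0 is left out so that its power can fill up each monomial to degree t. *)
  set V := ~: J i0 :\ j0.
  have <- : size [seq (m + U_(j0) *+ (t - mdeg m))%MM | m <- mons (enum V) t]
      = 'C(t + g, g).
    by rewrite size_map size_mons_set card_setC_D1 // hi0.
  have zero_out m i : m \in mons (enum V) t -> i \notin V -> m i = 0%N.
    rewrite mem_mons_set => /andP [_ /eqP h] hi; apply/eqP; rewrite -leqn0 -h /wdeg.
    have hiC : i \in ~: V by rewrite in_setC.
    by rewrite (bigD1 i hiC) /= leq_addr.
  have degV m : m \in mons (enum V) t -> (mdeg m <= t)%N.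
    by rewrite mem_mons_set => /andP [].
  apply: (hilbert_ge I_monomial_ideal inI_up hH).
    rewrite map_inj_in_uniq ?mons_uniq ?enum_uniq // => m m' hm hm' emm.
    apply/mnmP => i; have := congr1 (fun x : mon => x i) emm.
    rewrite !mnmDE !mulmnE !mnm1E; case: (eqVneq j0 i) => [<-|_]; last by lia.
    by rewrite !(zero_out _ j0) // /V !inE eqxx.
  move=> _ /mapP [m hm ->]; rewrite mdegD mdegMn mdeg1 mul1n subnKC ?degV //; split=> //.
  apply/negP => /forallP /(_ i0); rewrite wdegD wdegMn wdegU (negbTE hj0) addn0 leqNgt.
  rewrite (_ : wdeg _ _ = 0%N) ?a_gt0 // /wdeg big1 // => i hi.
  by apply: zero_out hm _; rewrite /V !inE hi andbF.
rewrite -hP // -natrM ler_nat.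
pose cov X := if [pick j | j \notin X] is Some j then cover X j (comp_exp X) t else [::].
have hle : (H t <= \sum_(X in comps) size (cov X))%N.
  have <- : size (flatten [seq cov X | X <- enum comps]) = (\sum_(X in comps) size (cov X))%N.
    by rewrite size_flatten sumnE /shape -map_comp big_map big_enum.
  apply: (hilbert_le I_monomial_ideal hH) => m hm /not_inI [X hX hw].
  apply/flatten_mapP; exists X; first by rewrite mem_enum.
  rewrite /cov; case: pickP => [j hj|h]; first exact: mem_cover.
  have eX : X = setT by apply/setP => j; have := h j; rewrite inE; case: (j \in X).
  by move: hw hT; rewrite eX wdegT hm; lia.
have htop : top_comps \subset comps by apply/subsetP => X; rewrite inE => /andP [].
have cov_top X : X \in top_comps -> size (cov X) = (multichoose (comp_exp X) c * 'C(t + g, g))%N.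
  rewrite inE => /andP [hX /eqP hXc]; rewrite /cov; case: pickP => [j hj|h].
    by rewrite size_cover ?comp_exp_gt0 // hXc.
  have eX : X = setT by apply/setP => j; have := h j; rewrite inE; case: (j \in X).
  by move: hXc; rewrite eX cardsT card_ord; lia.
have cov_rest X : X \in comps :\: top_comps ->
    (t.+1 * size (cov X) <= multichoose (comp_exp X) #|X| * t.+1 ^ g)%N.
  rewrite !inE => /andP [hn hX]; rewrite hX /= in hn; rewrite /cov.
  case: pickP => [j hj|_]; last by rewrite muln0.
  have hcX : (c < #|X|)%N.
    by rewrite ltn_neqAle eq_sym hn; case/imsetP: hX => i _ ->; apply: c_max.
  have hXn : (#|X| < n)%N.
    rewrite ltnNge; apply/negP => h; move/negP: hj; apply.
    suff -> : X = setT by rewrite inE.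
    by apply/eqP; rewrite eqEcard subsetT cardsT card_ord.
  rewrite size_cover ?comp_exp_gt0 // mulnCA leq_mul2l; apply/orP; right.
  apply: (@leq_trans (t.+1 * t.+1 ^ (n - #|X|).-1)); first by rewrite leq_mul2l bin_le_exp orbT.
  by rewrite -expnS leq_pexp2l // /g; lia.
apply: (@leq_trans (t.+1 * \sum_(X in comps) size (cov X))); first by rewrite leq_mul2l hle orbT.
rewrite (big_setID top_comps) /= (setIidPr htop) mulnDr; apply: leq_add.
  rewrite (eq_bigr _ cov_top) -big_distrl /= -/mult_bound.
  by rewrite mulnA (mulnC t.+1).
rewrite big_distrr /= /K big_distrl /=; exact: leq_sum.
Qed.

Lemma mult_le e : multiplicity I e -> e <= mult_bound%:R.
Proof.
have : (c <= n)%N.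
  by have [i <-] := c_att; rewrite -[X in (_ <= X)%N]card_ord max_card.
rewrite leq_eqVlt => /orP [/eqP|]; [exact: mult_le_artinian | exact: mult_le_positive_dim].
Qed.

Variable F : min_graded_resolution I.

(* If every J_i meets T, some monomial of I is supported on T, and hence so is
   some monomial of some minimal generator. *)
Lemma generator_degree (T : {set 'I_n}) D : (forall i, J i :&: T != set0) ->
  (forall m, inI m -> wdeg (~: T) m = 0%N -> (D <= mdeg m)%N) ->
  (D <= max_shift F 1)%N.
Proof.
move=> hT hD; pose m0 : mon := (mesym1 T *+ \max_i a i)%MM.
have m0T : wdeg (~: T) m0 = 0%N by rewrite wdegMn wdeg_mesym1 setIC setICr cards0.
have m0I : inI m0.
  apply/forallP => i; rewrite wdegMn wdeg_mesym1.
  apply: leq_trans (bigop.leq_bigmax i) _; rewrite leq_pmull // card_gt0; exact: hT.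
have /I_monomial_ideal : monomial_ideal inI ('X_[m0] : R) by apply/monomial_idealX.
move=> /(dif_augment F) [w hw].
have o0 : 'I_(rk F 0) by rewrite (rk0 F); exact: ord0.
have e0 : 'X_[m0] = \sum_j w 0 j * dif F 0 j o0.
  by have := congr1 (fun Y : 'M_(_, _) => Y 0 o0) hw; rewrite !mxE => <-.
have : m0 \in msupp (\sum_j w 0 j * dif F 0 j o0) by rewrite -e0 msuppX inE.
move=> /msupp_sum_le /flatten_mapP [j _ /msuppM_le /allpairsP [[m1 m2] /= [_ h2 em]]].
have m2I : inI m2.
  suff /I_monomial_ideal : I (dif F 0 j o0) by apply.
  apply/(dif_augment F); exists (delta_mx 0 j); rewrite -rowE.
  by apply/matrixP => x y; rewrite !mxE (ord_rk0 y o0).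
have m2T : wdeg (~: T) m2 = 0%N by move: m0T; rewrite em wdegD; lia.
apply: leq_trans (hD _ m2I m2T) _.
have := dif_homog h2; rewrite dg0 addn0 => ->.
exact: (bigop.leq_bigmax j).
Qed.

(** The members of S are disjoint inside T, so the degree of a monomial supported on T is at least
    the sum of its X-degrees. *)
Lemma sum_comp_exp_le (S : {set {set 'I_n}}) (T : {set 'I_n}) : S \subset comps ->
  (forall i, J i :&: T != set0) ->
  (forall j, j \in T -> {in S &, forall X Y, j \in X -> j \in Y -> X = Y}) ->
  (\sum_(X in S) comp_exp X <= max_shift F 1)%N.
Proof.
move=> hS hT hdisj; apply: generator_degree hT _ => m hm hmT.
apply: (@leq_trans (\sum_(X in S) wdeg X m)).
  by apply: leq_sum => X hX; apply: comp_exp_le => //; apply: (subsetP hS).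
rewrite /wdeg; under eq_bigr do rewrite big_mkcond /=.
rewrite exchange_big mdegE /=; apply: leq_sum => j _.
case: (boolP (j \in T)) => hj; last first.
  have -> : m j = 0%N.
    apply/eqP; rewrite -leqn0 -hmT /wdeg (bigD1 j) ?inE //=; exact: leq_addr.
  by rewrite big1 // => X _; case: ifP.
case: (pickP (fun X => (X \in S) && (j \in X))) => [X /andP [hX hjX]|h].
  rewrite (bigD1 X) //= hjX big1 ?addn0 // => Y /andP [hY ne].
  by case: ifP => // hjY; case/eqP: ne; apply: (hdisj j).
by rewrite big1 // => X hX; have := h X; rewrite hX /= => ->.
Qed.

Hypothesis c_gt0 : (0 < c)%N.

Lemma comp_exp_max X : X \in comps -> (comp_exp X <= max_shift F 1)%N.
Proof.
move=> hX; have := @sum_comp_exp_le [set X] setT; rewrite big_set1; apply.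
- by rewrite sub1set.
- by move=> i; rewrite setIT -card_gt0 (leq_trans c_gt0).
- by move=> j _ Y Z /set1P -> /set1P ->.
Qed.

(** Take T to be the complement of X :&: Y. Every J_i meets T because X :&: Y has fewer than c
    elements. *)
Lemma comp_exp_pair X Y : X \in top_comps -> Y \in top_comps -> X != Y ->
  (comp_exp X + comp_exp Y <= max_shift F 1)%N.
Proof.
rewrite !inE => /andP [hX /eqP cX] /andP [hY /eqP cY] ne.
have := @sum_comp_exp_le [set X; Y] (~: (X :&: Y)).
rewrite big_setU1 ?inE //= big_set1; apply.
- by apply/subsetP => Z /set2P [] ->.
- move=> i; apply/negP; rewrite -setDE setD_eq0 => /subset_leq_card h.
  have : (c <= #|X :&: Y|)%N by apply: leq_trans (c_max i) h.
  move=> hc; case/eqP: ne; have hXY : X :&: Y = X.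
    by apply/eqP; rewrite eqEcard subsetIl cX.
  by apply/eqP; rewrite eqEcard cX cY leqnn andbT -hXY subsetIr.
- move=> j; rewrite !inE => hj Z W /set2P [] -> /set2P [] -> // h1 h2;
  by move: hj; rewrite h1 h2.
Qed.

Lemma mult_bound_le :
  (c = 1 \/ #|top_comps| <= c.+1)%N -> (mult_bound <= multichoose (max_shift F 1) c)%N.
Proof.
case=> [c1|hr]; last first.
  apply: sum_multichoose_le => // [X hX|X Y]; last exact: comp_exp_pair.
  have hX' : X \in comps by move: hX; rewrite inE => /andP [].
  by rewrite comp_exp_gt0 ?comp_exp_max.
rewrite /mult_bound c1 multichoose1 (eq_bigr (fun X => comp_exp X)); last first.
  by move=> X _; rewrite multichoose1.
apply: (@sum_comp_exp_le _ setT).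
- by apply/subsetP => X; rewrite inE => /andP [].
- by move=> i; rewrite setIT -card_gt0 (leq_trans c_gt0).
- move=> j _ X Y; rewrite !inE c1 => /andP [_ /cards1P [x ->]] /andP [_ /cards1P [y ->]].
  by move=> /set1P <- /set1P <-.
Qed.

(** If s <= 3, then c >= 2 already suffices. Otherwise fix X0 of size c and send each other X of
    size c to an element of X0 outside X. This map is injective, since X :|: Y = [n] leaves no
    element outside both; so there are at most c such X. *)
Lemma card_top_comps :
  (s <= 3)%N \/ (forall i j, i != j -> J i :|: J j = setT) ->
  (c = 1 \/ #|top_comps| <= c.+1)%N.
Proof.
have htop : (#|top_comps| <= s)%N.
  apply: leq_trans (_ : #|comps| <= _)%N.
    by apply/subset_leq_card/subsetP => X; rewrite inE => /andP [].
  by apply: leq_trans (leq_imset_card _ _) _; rewrite card_ord.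
case=> [s3|hU]; first by case: (ltngtP c 1) => hc; [lia|right; lia|left].
right; have [X0 hX0] : exists X, X \in top_comps.
  by have [i hi] := c_att; exists (J i); rewrite inE hi eqxx imset_f.
rewrite (cardsD1 X0) hX0 add1n ltnS.
have [X0c cX0] : X0 \in comps /\ #|X0| = c.
  by move: hX0; rewrite inE => /andP [-> /eqP].
have compU X Y : X \in comps -> Y \in comps -> X != Y -> X :|: Y = setT.
  move=> /imsetP [i _ ->] /imsetP [j _ ->] ne; apply: hU.
  by apply: contraNneq ne => ->.
have pickC X : exists j, (X \in top_comps :\ X0) ==> (j \in X0) && (j \notin X).
  case: (boolP (X \in top_comps :\ X0)) => [|_]; last first.
    have : (0 < #|X0|)%N by rewrite cX0.
    by rewrite card_gt0 => /set0Pn [j _]; exists j.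
  rewrite !inE => /and3P [ne hX /eqP cX].
  have /subsetPn [j h1 h2] : ~~ (X0 \subset X).
    by apply: contra ne => h; rewrite eq_sym eqEcard h cX cX0 leqnn.
  by exists j; rewrite h1 h2.
have /fin_all_exists [f hf] := pickC.
rewrite -cX0 -(card_in_imset (f := f)).
  apply/subset_leq_card/subsetP => _ /imsetP [X hX ->].
  by have := hf X; rewrite hX => /andP [].
move=> X Y hX hY e; apply/eqP; apply: contraT => ne.
have := hf X; have := hf Y; rewrite hX hY -e /= => /andP [_ hY'] /andP [_ hX'].
have hc Z : Z \in top_comps :\ X0 -> Z \in comps by rewrite !inE => /and3P [].
have := compU X Y (hc _ hX) (hc _ hY) ne; move/setP/(_ (f X)).
by rewrite !inE (negbTE hX') (negbTE hY').
Qed.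

Lemma max_shift_ge i : (0 < i <= c)%N -> (max_shift F 1 + i.-1 <= max_shift F i)%N.
Proof.
have [fs [sfs rfs hfs]] : exists fs : seq R, [/\ size fs = c,
    regular_seq (fun r => r = 0) fs & forall f, f \in fs -> forall i, weight_ideal (J i) (a i) f].
  apply: regular_seq_weight_ideal => //; have [j <-] := c_att.
  by rewrite -[X in (_ <= X)%N]card_ord max_card.
have M0 : (0 < max_shift F 1)%N.
  have [j _] := c_att; have hj : J j \in comps by apply: imset_f.
  exact: leq_trans (comp_exp_gt0 hj) (comp_exp_max hj).
elim: i => [|[|i] IH] // hi; first by rewrite addn0.
have {}IH : (max_shift F 1 + i <= max_shift F i.+1)%N by apply: IH; lia.
have /= := @max_shift_lt _ _ _ F i.+1 fs _ rfs; rewrite addnS => h.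
apply: leq_ltn_trans (IH) _; apply: h; first by move=> f /hfs /hI.
  by rewrite sfs.
by apply: leq_trans IH; rewrite ltn_addr.
Qed.

End IntersectionIdeal.

Theorem corollary6p2 (k : fieldType) (char0 : [pchar k] =i pred0)
    (n s : nat) (s_gt0 : (0 < s)%N)
    (J : 'I_s -> {set 'I_n}) (J_neq0 : forall i, J i != set0)
    (a : 'I_s -> nat) (a_gt0 : forall i, (0 < a i)%N)
    (I : {mpoly k[n]} -> Prop)
    (defI : forall f, I f <-> forall i, ideal_pow (@mJ k n (J i)) (a i) f)
    (hyp : (s <= 3)%N \/ forall i j, i != j -> J i :|: J j = [set: 'I_n])
    (c : nat) (codimI : codim I c)
    (e : rat) (multI : multiplicity I e)
    (F : min_graded_resolution I) :
  e <= (\prod_(1 <= i < c.+1) max_shift F i)%:R / (c`!)%:R.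
Proof.
have hI f : I f <-> forall i, weight_ideal (J i) (a i) f.
  by rewrite defI; split=> h i; apply/ideal_pow_mJ.
have [c_att c_max] := codim_intersection s_gt0 a_gt0 hI codimI.
have c_gt0 : (0 < c)%N by have [i <-] := c_att; rewrite card_gt0.
apply: le_trans (mult_le a_gt0 hI c_max c_att multI) _.
rewrite ler_pdivlMr ?ltr0n ?fact_gt0 // -natrM ler_nat.
have hb := mult_bound_le a_gt0 hI c_max F c_gt0 (card_top_comps c_att c_gt0 hyp).
apply: leq_trans (leq_mul hb (leqnn _)) _.
(* The left side becomes the product of the M_1 + i - 1, to be compared with the M_i factor by
   factor. *)
rewrite multichoose_fact big_nat_cond [X in (_ <= X)%N]big_nat_cond.
by apply: leq_prod => i; rewrite andbT => hi; apply: max_shift_ge hi.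
Qed.
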